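(* Let $\phi:\mathbb{N}\to\mathbb{R}_+$ be a monotonically increasing positive function with $$\lim_{n\to\infty}\frac{\phi(n)}{n}=\infty,\qquad \lim_{n\to\infty}\frac{\phi(n+1)}{\phi(n)}=1,\qquad \limsup_{n\to\infty}\frac{\log\log\phi(n)}{\log n}<\frac12 .$$ Then $\dim_{\mathcal H}E(\phi)=1$.
   Context: Every irrational $x\in(0,1)$ has a unique simple continued fraction expansion $x=[a_1(x),a_2(x),a_3(x),\ldots]=\cfrac{1}{a_1(x)+\cfrac{1}{a_2(x)+\cdots}}$ with positive integers $a_n(x)$ (partial quotients). For irrational $x\in(0,1)$ and $n\ge1$, $S_n(x)=\sum_{i=1}^n a_i(x)a_{i+1}(x)$. For a function $\phi:\mathbb N\to\mathbb R_+$, $E(\phi)$ is the set of (irrational) $x\in(0,1)$ such that $\lim_{n\to\infty}S_n(x)/\phi(n)=1$. $\dim_{\mathcal H}$ denotes Hausdorff dimension. *)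

(* Defs.v *)
From HB Require Import structures.
From mathcomp Require Import all_boot all_order all_algebra.
From mathcomp Require Import all_classical all_reals all_analysis.
From mathcomp Require Import ring lra.

Set Implicit Arguments.
Unset Strict Implicit.
Unset Printing Implicit Defensive.

Import Order.TTheory GRing.Theory Num.Theory.
Import numFieldNormedType.Exports.

Local Open Scope classical_set_scope.
Local Open Scope ring_scope.

Section ContinuedFractions.
Context {R : realType}.
Implicit Types (a b : nat -> nat) (x : R).

(* [a_1, ..., a_n] = 1/(a_1 + 1/(a_2 + ... + 1/a_n)), where the partial
   quotient a_i is stored in the sequence at index i - 1; the value is 0 when
   n = 0. *)
Fixpoint cfrac_convergent a n : R :=
  if n is m.+1 then ((a 0)%:R + cfrac_convergent (fun i => a i.+1) m)^-1
  else 0.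

Definition is_cfrac_expansion x a : Prop :=
  (forall i, (0 < a i)%N) /\ cfrac_convergent a n @[n --> \oo] --> x.

Lemma cfrac_convergent_ge0 a n : 0 <= cfrac_convergent a n.
Proof. by elim: n a => [|n IH] a //=; rewrite invr_ge0 addr_ge0. Qed.

Lemma cfrac_convergent_le1 a n :
  (forall i, (0 < a i)%N) -> cfrac_convergent a n <= 1.
Proof.
move=> a0; case: n => [|n] //=; have a1 : 1 <= (a 0)%:R :> R by rewrite ler1n.
have c0 := cfrac_convergent_ge0 (fun i => a i.+1) n.
by rewrite invf_le1; lra.
Qed.

Lemma irrational_cfrac_tail x n :
  irrational x -> irrational (x^-1 - n%:R).
Proof.
move=> ix [q _ qE]; apply: ix; exists (q + n%:R)^-1 => //.
by rewrite fmorphV rmorphD/= rmorph_nat qE subrK invrK.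
Qed.

Lemma irrational01 x : irrational x -> 0 <= x <= 1 -> 0 < x < 1.
Proof.
move=> ix /andP[x0 x1]; rewrite !lt_neqAle x0 x1 !andbT.
apply/andP; split; apply/eqP => xE; apply: ix.
  by exists 0 => //; rewrite rmorph0.
by exists 1 => //; rewrite rmorph1.
Qed.

Lemma is_cfrac_expansion_bound x a :
  is_cfrac_expansion x a -> 0 <= x <= 1.
Proof.
move=> [a0 ax]; have xE := cvg_lim (@Rhausdorff R) ax.
have cx : cvgn (cfrac_convergent a) by apply/cvg_ex; exists x.
apply/andP; split; rewrite -xE.
  by apply: limr_ge => //; near=> n; exact: cfrac_convergent_ge0.
by apply: limr_le => //; near=> n; exact: cfrac_convergent_le1.
Unshelve. all: by end_near. Qed.

Lemma is_cfrac_expansion_tail x a : irrational x ->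
  is_cfrac_expansion x a ->
  is_cfrac_expansion (x^-1 - (a 0)%:R) (fun i => a i.+1).
Proof.
move=> ix xa; have /andP[x0 _] := irrational01 ix (is_cfrac_expansion_bound xa).
case: xa => a0 ax; split=> //.
have axS : cfrac_convergent a n.+1 @[n --> \oo] --> x by rewrite cvg_shiftS.
rewrite (_ : (fun n => _) = fun n => (cfrac_convergent a n.+1)^-1 - (a 0)%:R).
  exact: cvgB (cvgV (lt0r_neq0 x0) axS) (cvg_cst _).
by apply/funext => n /=; rewrite invrK addrC addKr.
Qed.

Lemma is_cfrac_expansion_head x a : irrational x ->
  is_cfrac_expansion x a -> a 0 = Num.truncn x^-1.
Proof.
move=> ix xa; have xa' := is_cfrac_expansion_tail ix xa.
have := irrational01 (irrational_cfrac_tail (n := a 0) ix)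
  (is_cfrac_expansion_bound xa').
move=> /andP[h1 h2]; apply/esym/truncn_def; rewrite -natr1.
by apply/andP; split; lra.
Qed.

Lemma is_cfrac_expansion_unique x a b : irrational x ->
  is_cfrac_expansion x a -> is_cfrac_expansion x b -> a = b.
Proof.
move=> ix xa xb; apply/funext => n; elim: n => [|n IH] in x a b ix xa xb *.
  by rewrite (is_cfrac_expansion_head ix xa) (is_cfrac_expansion_head ix xb).
have xa' := is_cfrac_expansion_tail ix xa.
have xb' := is_cfrac_expansion_tail ix xb.
rewrite (is_cfrac_expansion_head ix xb) -(is_cfrac_expansion_head ix xa) in xb'.
exact: IH (irrational_cfrac_tail ix) xa' xb'.
Qed.

Let gauss x := x^-1 - (Num.truncn x^-1)%:R.
Let digits x i := Num.truncn (iter i gauss x)^-1.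

Let gaussP x : irrational x -> 0 < x < 1 ->
  [/\ irrational (gauss x), 0 < gauss x < 1 & (0 < Num.truncn x^-1)%N].
Proof.
move=> ix /andP[x0 x1]; have ig := irrational_cfrac_tail (n := Num.truncn x^-1) ix.
have xV : 1 <= x^-1 by rewrite invf_ge1 // ltW.
have xV0 : 0 <= x^-1 by lra.
have /andP[t1 t2] := truncn_itv xV0; rewrite -natr1 in t2.
split=> //; last by rewrite truncn_gt0.
by apply: irrational01 => //; rewrite /gauss; lra.
Qed.

Let digits_gt0 x : irrational x -> 0 < x < 1 ->
  forall i, (0 < digits x i)%N.
Proof.
move=> ix x01 i; rewrite /digits.
elim: i x ix x01 => [|i IH] x ix x01; first by case: (gaussP ix x01).
by case: (gaussP ix x01) => ? ? _; rewrite iterSr; exact: IH.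
Qed.

Let digitsS x : (fun i => digits x i.+1) = digits (gauss x).
Proof. by apply/funext => i; rewrite /digits iterSr. Qed.

Let digits_err x n : irrational x -> 0 < x < 1 ->
  `|cfrac_convergent (digits x) n - x| <= 2 * 2^-1 ^+ n.
Proof.
move: n x; suff H n x : irrational x -> 0 < x < 1 ->
  (`|cfrac_convergent (digits x) n - x| <= 2 * 2^-1 ^+ n) /\
  (`|cfrac_convergent (digits x) n.+1 - x| <= 2 * 2^-1 ^+ n.+1).
  by move=> n x ix x01; case: (H n x ix x01).
elim: n x => [|n IH] x ix x01.
  have d0 := digits_gt0 ix x01.
  have c0 := cfrac_convergent_ge0 (digits x) 1.
  have c1 := cfrac_convergent_le1 1 d0.
  by rewrite expr0 expr1; split; rewrite ler_norml; [rewrite /=|]; lra.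
split; first by case: (IH x ix x01).
have [ig g01 _] := gaussP ix x01; have [igg gg01 _] := gaussP ig g01.
have [+ _] := IH _ igg gg01.
have p0 := digits_gt0 ix x01; have p1 := digits_gt0 ig g01.
have c0 := cfrac_convergent_ge0 (digits (gauss (gauss x))) n.
move: c0; rewrite [cfrac_convergent (digits x) _]/= -/(digits x 0).
rewrite (_ : (fun i => digits x i.+2) = digits (gauss (gauss x))); last first.
  by rewrite -!digitsS; apply/funext.
set c := cfrac_convergent _ n => c0 cg.
have A1 : 1 <= (digits x 0)%:R :> R by rewrite ler1n.
have B1 : 1 <= (digits x 1)%:R :> R by rewrite ler1n.
have xE : x = ((digits x 0)%:R + ((digits x 1)%:R + gauss (gauss x))^-1)^-1.
  have gE y : y = ((Num.truncn y^-1)%:R + gauss y)^-1.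
    by rewrite /gauss addrC subrK invrK.
  by rewrite {1}(gE x); congr (_ + _)^-1; exact: gE.
move: gg01 => /andP[g0 g1].
rewrite [X in _ - X]xE; clear xE; move: (gauss (gauss x)) g0 g1 cg => g g0 g1 cg.
rewrite -[0.+1]/1%N.
move: ((digits x 0)%:R) A1 ((digits x 1)%:R) B1 => A A1 B B1.
have -> : (A + (B + c)^-1)^-1 - (A + (B + g)^-1)^-1 =
   (c - g) / ((A * (B + c) + 1) * (A * (B + g) + 1)).
  by field; rewrite !gt_eqF //; nra.
have P2 : 2 <= A * (B + c) + 1 by nra.
have Q2 : 2 <= A * (B + g) + 1 by nra.
have D4 : 4 <= (A * (B + c) + 1) * (A * (B + g) + 1) by nra.
have e0 : 0 <= 2^-1 ^+ n :> R by rewrite exprn_ge0.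
rewrite normrM normfV [X in _ / X]ger0_norm; last by lra.
rewrite ler_pdivrMr; last by lra.
rewrite !exprS; apply: (le_trans cg).
move: D4 e0; move: (_ ^+ n) => e; move: (_ * _) => D D4 e0.
by nra.
Qed.

Lemma is_cfrac_expansion_exists x : irrational x -> 0 < x < 1 ->
  exists a, is_cfrac_expansion x a.
Proof.
move=> ix x01; exists (digits x); split; first exact: digits_gt0.
have geo : 2 * 2^-1 ^+ n @[n --> \oo] --> (0 : R).
  rewrite -[X in _ --> X](mulr0 2); apply: cvgMr.
  by apply: cvg_expr; rewrite ger0_norm; lra.
apply/cvgrPdist_le => e e0; near=> n; rewrite distrC.
apply: (le_trans (digits_err n ix x01)).
rewrite -[leLHS]ger0_norm ?mulr_ge0 ?exprn_ge0 ?invr_ge0 //.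
rewrite -[X in `|X|]subr0 distrC.
by near: n; move/cvgrPdist_le : geo; apply.
Unshelve. all: by end_near. Qed.

Definition cfrac_expansion x : nat -> nat :=
  xget (fun=> 1%N) [set a | is_cfrac_expansion x a].

Lemma cfrac_expansionP x : irrational x -> 0 < x < 1 ->
  is_cfrac_expansion x (cfrac_expansion x).
Proof.
move=> ix x01; have [a xa] := is_cfrac_expansion_exists ix x01.
exact: xgetPex (ex_intro _ a xa).
Qed.

(* The partial quotient a_n(x), for n >= 1. *)
Definition partial_quotient x n : nat := cfrac_expansion x n.-1.

Definition S_ n x : nat :=
  (\sum_(1 <= i < n.+1) partial_quotient x i * partial_quotient x i.+1)%N.

Definition E_ (phi : nat -> R) : set R :=
  [set x | [/\ irrational x, 0 < x < 1 &
    (S_ n x)%:R / phi n @[n --> \oo] --> (1 : R)]].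

End ContinuedFractions.

Section HausdorffDimension.
Context {R : realType}.
Implicit Types (A U : set R) (s delta : R).
Local Open Scope ereal_scope.

(* diam set0 = -oo. *)
Definition diam U : \bar R :=
  ereal_sup [set (`|p.1 - p.2|)%:E | p in U `*` U].

(* |U|^s with the usual conventions |set0|^s = 0 and |{x}|^0 = 1. *)
Definition diam_pow s U : \bar R :=
  if U == set0 then 0 else diam U `^ s.

Definition hausdorff_content s delta A : \bar R :=
  ereal_inf [set \sum_(i <oo) diam_pow s (U i) |
    U in [set U : (set R)^nat |
      A `<=` \bigcup_i U i /\ forall i, diam (U i) <= delta%:E]].

(* The limit as delta -> 0+ is a supremum, the content being monotone in
   delta. *)
Definition hausdorff_measure s A : \bar R :=
  ereal_sup [set hausdorff_content s delta A | delta in [set d | (0 < d)%R]].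

Definition hausdorff_dim A : \bar R :=
  ereal_inf [set s%:E | s in [set s | (0 <= s)%R /\ hausdorff_measure s A = 0]].

End HausdorffDimension.

(* Main.v *)
(* The upper bound is a covering of [0, 1] by N intervals of length 1/N. For the
   lower bound, prescribe partial quotients on a sparse set of positions, namely
   blocks 1, b, 1 whose entries b make S_n follow phi(n), and let the other
   partial quotients run freely through 1, ..., M; the free ones contribute O(n)
   to S_n. Spread mass over these numbers by restricting normalised Lebesgue
   measure to the free digits <= M: a cylinder of order n gets mass at most
   q_n^(-2) (1 + 2/M)^n times the product of (b + 1)^2 over the prescribed digits
   b met so far. Since phi(n) <= exp(n^beta) with beta < 1/2, the positions can be
   chosen so sparse that this product is exp(o(n)), and q_n^2 grows like 2^n at
   least, so that for M large the mass is at most C q_n^(-2 s) for any given s < 1.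
   Two numbers that first differ at order n are at distance at least c q_n^(-2);
   hence coding t in [0, 1) by the resulting digits gives
   |t - u| <= C |x(t) - x(u)|^s, and a cover of the numbers x(t) pulls back to a
   cover of [0, 1). *)

Require Import Defs.
From mathcomp Require Import all_boot all_order all_algebra.
From mathcomp Require Import all_classical all_reals all_analysis.
From mathcomp Require Import ring lra zify.

Set Implicit Arguments.
Unset Strict Implicit.
Unset Printing Implicit Defensive.

Import Order.TTheory GRing.Theory Num.Theory.
Import numFieldNormedType.Exports.

Local Open Scope classical_set_scope.
Local Open Scope ring_scope.

(** * Numbers with a prescribed sequence of partial quotients *)

Section CfracValue.
Context {R : realType}.
Implicit Types (a b : nat -> nat) (x : R).

(** One level of the fraction need not contract, as its denominator may be close to 1. Two levels
    divide distances by at least 4, hence the induction by steps of two. *)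
Lemma cfrac_convergent_dist a k m n :
  (forall i, (0 < a i)%N) -> (k <= m)%N -> (k <= n)%N ->
  `|cfrac_convergent a m - cfrac_convergent a n| <= 2 * 2^-1 ^+ k :> R.
Proof.
elim/ltn_ind: k a m n => k IH a m n a0 km kn.
have cB b l : (forall i, (0 < b i)%N) -> 0 <= (cfrac_convergent b l : R) <= 1.
  by move=> b0; rewrite cfrac_convergent_ge0 cfrac_convergent_le1.
have /andP[cm0 cm1] := cB a m a0; have /andP[cn0 cn1] := cB a n a0.
case: k IH km kn => [|[|k]] IH km kn.
- by rewrite expr0 ler_norml; lra.
- by rewrite expr1 ler_norml; lra.
case: m km cm0 cm1 => [|[|m]] // km _ _; case: n kn cn0 cn1 => [|[|n]] // kn _ _.
rewrite /=.
have a20 : forall i, (0 < a i.+2)%N by [].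
have /andP[+ _] := cB _ m a20; have /andP[+ _] := cB _ n a20.
have := IH k (leqnSn _) _ _ _ a20 km kn.
have A1 : 1 <= (a 0)%:R :> R by rewrite ler1n.
have B1 : 1 <= (a 1)%:R :> R by rewrite ler1n.
move: (cfrac_convergent _ m) (cfrac_convergent _ n) A1 B1 => c g.
move: ((a 0)%:R) ((a 1)%:R) => A B A1 B1 cg g0 c0.
rewrite -[0.+1]/1%N -/(2^-1).
have -> : (A + (B + c)^-1)^-1 - (A + (B + g)^-1)^-1 =
   (c - g) / ((A * (B + c) + 1) * (A * (B + g) + 1)).
  by field; rewrite !gt_eqF //; nra.
have P2 : 2 <= A * (B + c) + 1 by nra.
have Q2 : 2 <= A * (B + g) + 1 by nra.
have D4 : 4 <= (A * (B + c) + 1) * (A * (B + g) + 1) by nra.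
have e0 : 0 <= 2^-1 ^+ k :> R by rewrite exprn_ge0.
rewrite normrM normfV [X in _ / X]ger0_norm; last by lra.
rewrite ler_pdivrMr; last by lra.
rewrite !exprS; apply: (le_trans cg).
move: D4 e0; move: (_ ^+ k) => e; move: (_ * _) => D D4 e0.
by nra.
Qed.

Definition cfrac_value a : R := limn (cfrac_convergent a).

Lemma cfrac_valueP a : (forall i, (0 < a i)%N) ->
  is_cfrac_expansion (cfrac_value a) a.
Proof.
move=> a0; split=> //.
suff : cvgn (cfrac_convergent a : R^nat) by [].
apply/cauchy_cvgP/cauchyP => e e0.
have geo : 2 * 2^-1 ^+ n @[n --> \oo] --> (0 : R).
  rewrite -[X in _ --> X](mulr0 2); apply: cvgMl_tmp.
  by apply: cvg_expr; rewrite ger0_norm; lra.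
have [k _ /(_ k (leqnn k))/= kP] : \forall k \near \oo, 2 * 2^-1 ^+ k < e.
  by apply: (cvgr_lt _ geo).
exists (cfrac_convergent a k); exists k => // n /= kn.
by apply: le_lt_trans kP; exact: cfrac_convergent_dist.
Qed.

Lemma cfrac_value_bound a : (forall i, (0 < a i)%N) -> 0 <= cfrac_value a <= 1.
Proof. by move=> /cfrac_valueP/is_cfrac_expansion_bound. Qed.

Lemma cfrac_valueS a : (forall i, (0 < a i)%N) ->
  cfrac_value a = ((a 0)%:R + cfrac_value (fun i => a i.+1))^-1.
Proof.
move=> a0; have [_ ca] := cfrac_valueP a0.
have [_ cb] := @cfrac_valueP (fun i => a i.+1) (fun i => a0 i.+1).
have /andP[b0 b1] := @cfrac_value_bound (fun i => a i.+1) (fun i => a0 i.+1).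
have caS : cfrac_convergent a n.+1 @[n --> \oo] --> cfrac_value a by rewrite cvg_shiftS.
apply: (cvg_unique _ caS) => //=; apply: cvgV; last exact: cvgD (cvg_cst _) cb.
by have : 1 <= (a 0)%:R :> R; [rewrite ler1n|move=> ?; apply: lt0r_neq0; lra].
Qed.

Lemma cfrac_value01 a : (forall i, (0 < a i)%N) -> 0 < cfrac_value a < 1.
Proof.
have pos b : (forall i, (0 < b i)%N) -> 0 < cfrac_value b.
  move=> b0; rewrite (cfrac_valueS b0) invr_gt0.
  have /andP[? _] := @cfrac_value_bound (fun i => b i.+1) (fun i => b0 i.+1).
  by have : 1 <= (b 0)%:R :> R; [rewrite ler1n|lra].
move=> a0; rewrite pos//= (cfrac_valueS a0).
have := pos (fun i => a i.+1) (fun i => a0 i.+1).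
have : 1 <= (a 0)%:R :> R by rewrite ler1n.
by move=> ? ?; rewrite invf_lt1; lra.
Qed.

(** Infinite descent: if the value is m / q, then 0 < m < q and the tail is (q - b_0 m) / m, a
    fraction with the smaller denominator m. *)
Lemma cfrac_value_irrational a : (forall i, (0 < a i)%N) ->
  irrational (cfrac_value a).
Proof.
have key q b m : (forall i, (0 < b i)%N) -> cfrac_value b * q%:R = m%:R -> q = 0%N.
  elim/ltn_ind: q b m => q IH b m b0 bm; have [//|q0] := posnP q.
  have /andP[v0 v1] := cfrac_value01 b0.
  have q0' : 0 < q%:R :> R by rewrite ltr0n.
  have mq : (m < q)%N by rewrite -(ltr_nat R) -bm; nra.
  have m0 : (0 < m)%N by rewrite -(ltr_nat R) -bm; nra.
  have bE := cfrac_valueS b0.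
  have /andP[t0 t1] := @cfrac_value01 (fun i => b i.+1) (fun i => b0 i.+1).
  set t := cfrac_value (fun i => b i.+1) in bE t0 t1.
  have B1 : 1 <= (b 0)%:R :> R by rewrite ler1n.
  have tm : t * m%:R = q%:R - (b 0 * m)%:R.
    rewrite natrM -bm bE; move: t t0 t1 {bE} => t t0 t1.
    move: (b 0)%:R B1 q%:R => B B1 Q.
    by field; rewrite gt_eqF//; lra.
  have le : (b 0 * m <= q)%N.
    rewrite -(ler_nat R) -subr_ge0 -tm; apply: mulr_ge0 => //; exact: ltW.
  rewrite -natrB// in tm.
  by have := IH m mq _ _ (fun i => b0 i.+1) tm; lia.
move=> a0 [r _ rE]; have /andP[v0 v1] := cfrac_value01 a0.
have r0 : 0 < r by rewrite -(ltr0q R) rE.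
have : cfrac_value a * `|denq r|%N%:R = `|numq r|%N%:R.
  rewrite -rE !pmulrn !gez0_abs ?numq_ge0 ?ltW ?denq_gt0//.
  rewrite [X in ratr X](_ : r = (numq r)%:~R / (denq r)%:~R); last first.
    by rewrite divq_num_den.
  rewrite fmorph_div/= !ratr_int mulfVK// intr_eq0; exact: denq_neq0.
by move=> /(key _ _ _ a0)/eqP; rewrite absz_eq0 (negbTE (denq_neq0 _)).
Qed.

Lemma cfrac_expansion_value a : (forall i, (0 < a i)%N) ->
  cfrac_expansion (cfrac_value a) = a.
Proof.
move=> a0; have ia := cfrac_value_irrational a0.
apply: (is_cfrac_expansion_unique ia (cfrac_expansionP ia (cfrac_value01 a0))).
exact: cfrac_valueP.
Qed.

End CfracValue.

(** * Denominators of convergents and separation of numbers *)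

Section Denominators.
Context {R : realType}.
Implicit Types (a b : nat -> nat).

(* [cfrac_denom a n] is the denominator q_n of the n-th convergent, and
   [denom_ratio a n] is q_(n-1) / q_n. *)
Fixpoint denom_ratio a n : R :=
  if n is m.+1 then ((a m)%:R + denom_ratio a m)^-1 else 0.

Fixpoint cfrac_denom a n : R :=
  if n is m.+1 then cfrac_denom a m * ((a m)%:R + denom_ratio a m) else 1.

Lemma denom_ratio01 a n : (forall i, (0 < a i)%N) -> 0 <= denom_ratio a n <= 1.
Proof.
move=> a0; elim: n => [|n /andP[r0 r1]] /=; first by rewrite lexx ler01.
have A1 : 1 <= (a n)%:R :> R by rewrite ler1n.
by rewrite invr_ge0 invf_le1; lra.
Qed.

Lemma cfrac_denom_gt0 a n : (forall i, (0 < a i)%N) -> 0 < cfrac_denom a n.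
Proof.
move=> a0; elim: n => [|n IH] //=; have /andP[r0 _] := denom_ratio01 n a0.
have A1 : 1 <= (a n)%:R :> R by rewrite ler1n.
by apply: mulr_gt0 => //; lra.
Qed.

(** Two steps at least double the denominator: q_(n+2) = q_n (1 + a_(n+1) (a_n + r_n)), where r_n is
    [denom_ratio a n]. The factor 2 on the right pays for n = 1. *)
Lemma cfrac_denom_ge a n : (forall i, (0 < a i)%N) ->
  2 ^+ n <= 2 * cfrac_denom a n ^+ 2.
Proof.
move=> a0; elim/ltn_ind: n => -[|[|n]] IH.
- by rewrite expr0 expr1n; lra.
- have A1 : 1 <= (a 0)%:R :> R by rewrite ler1n.
  by rewrite expr1 /= mul1r addr0; nra.
have := IH n (leqnSn _); rewrite [cfrac_denom a n.+2]/=.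
have /andP[r0 r1] := denom_ratio01 n a0.
have q0 := cfrac_denom_gt0 n a0.
have A1 : 1 <= (a n)%:R :> R by rewrite ler1n.
have B1 : 1 <= (a n.+1)%:R :> R by rewrite ler1n.
rewrite -mulrA mulrDr mulfV ?gt_eqF//; last by lra.
rewrite exprMn !exprS.
set c := _ + 1; have c2 : 2 <= c by rewrite /c; nra.
have c4 : 4 <= c * (c * 1) by rewrite mulr1; nra.
move: (c * (c * 1)) c4 => c' c4.
by set d := cfrac_denom a n in q0 *; nra.
Qed.

Definition tail a n : nat -> nat := fun i => a (n + i)%N.

Lemma cfrac_value_tail a n : (forall i, (0 < a i)%N) ->
  cfrac_value (tail a n) = ((a n)%:R + cfrac_value (tail a n.+1))^-1 :> R.
Proof.
move=> a0; rewrite cfrac_valueS ?/tail ?addn0; last by move=> i; exact: a0.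
by congr (_ + cfrac_value _)^-1; apply/funext => i; rewrite addnS addSn.
Qed.

(** Telescoping: for the tail values x_i, the relation 1 / x_n = a_n + x_(n+1) turns q_(n+1) + q_n
    x_(n+1) into (q_n + q_(n-1) x_n) / x_n. *)
Lemma cfrac_denom_prod a n : (forall i, (0 < a i)%N) ->
  (\prod_(i < n) cfrac_value (tail a i)) *
    (cfrac_denom a n * (1 + denom_ratio a n * cfrac_value (tail a n))) = 1.
Proof.
move=> a0; elim: n => [|n IH]; first by rewrite big_ord0/= !mul1r mul0r addr0.
rewrite big_ord_recr/= -[RHS]IH -!mulrA; congr (_ * _).
have /andP[r0 r1] := denom_ratio01 n a0.
have A1 : 1 <= (a n)%:R :> R by rewrite ler1n.
rewrite (cfrac_value_tail n a0).
have /andP[v0 v1] := @cfrac_value01 R (tail a n.+1) (fun i => a0 _).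
move: (cfrac_value _) v0 v1 => v v0 v1.
move: (cfrac_denom a n) (denom_ratio a n) (a n)%:R r0 r1 A1 => q r A r0 r1 A1.
by field; rewrite !gt_eqF; lra.
Qed.

(** A common digit B scales the distance of the tails by 1 / ((B + v) (B + w)), a product of two
    tail values. By [cfrac_denom_prod] all these factors together are of order q_n^(-2). *)
Lemma cfrac_value_dist a b n : (forall i, (0 < a i)%N) -> (forall i, (0 < b i)%N) ->
  (forall i, (i < n)%N -> a i = b i) ->
  `|cfrac_value a - cfrac_value b| =
    `|cfrac_value (tail a n) - cfrac_value (tail b n)| *
    ((\prod_(i < n) cfrac_value (tail a i)) *
     (\prod_(i < n) cfrac_value (tail b i))) :> R.
Proof.
move=> a0 b0; elim: n => [|n IH] ab; first by rewrite !big_ord0 !mulr1.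
rewrite IH; last by move=> i ni; apply: ab; rewrite ltnS ltnW.
rewrite !big_ord_recr/= (cfrac_value_tail n a0) (cfrac_value_tail n b0) ab//.
have B1 : 1 <= (b n)%:R :> R by rewrite ler1n.
have /andP[v0 v1] := @cfrac_value01 R (tail a n.+1) (fun i => a0 _).
have /andP[w0 w1] := @cfrac_value01 R (tail b n.+1) (fun i => b0 _).
move: (cfrac_value (tail a n.+1)) (cfrac_value (tail b n.+1)) v0 v1 w0 w1.
move=> v w v0 v1 w0 w1; move: (\prod_(i < n) _) (\prod_(i < n) _) => P Q.
move: (b n)%:R B1 => B B1.
rewrite (_ : (B + v)^-1 - (B + w)^-1 = (w - v) / ((B + v) * (B + w))); last first.
  by field; rewrite !gt_eqF; lra.
rewrite normrM normfV [X in _ / X]ger0_norm; last by nra.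
rewrite distrC; move: `|v - w| => d.
by field; rewrite !gt_eqF; lra.
Qed.

(** Since k + v <= l, the numerator of the difference is at least w >= 1 / (M + 1), and the
    denominator is at most (M + 1)^2; together these give the cube. *)
Lemma invr_gap k l M (v w : R) : (k < l)%N -> (0 < k)%N -> (l <= M)%N ->
  0 <= v <= 1 -> M.+1%:R^-1 <= w -> w <= 1 ->
  1 <= M.+1%:R ^+ 3 * ((k%:R + v)^-1 - (l%:R + w)^-1).
Proof.
move=> kl k0 lM /andP[v0 v1] w0 w1.
have K1 : 1 <= k%:R :> R by rewrite ler1n.
have KL : k%:R + 1 <= l%:R :> R by rewrite natr1 ler_nat.
have LM : l%:R + 1 <= M.+1%:R :> R by rewrite natr1 ler_nat.
move: k%:R l%:R M.+1%:R K1 KL LM w0 => K L N K1 KL LM w0.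
have N0 : 0 < N by lra.
have w0' : 0 < w by apply: lt_le_trans w0; rewrite invr_gt0.
have -> : (K + v)^-1 - (L + w)^-1 = (L + w - K - v) / ((K + v) * (L + w)).
  by field; rewrite !gt_eqF; lra.
rewrite mulrA ler_pdivlMr; last by nra.
have Nw : 1 <= N * w by rewrite -ler_pdivrMl// mulr1.
have h1 : (K + v) * (L + w) <= N ^+ 2.
  by rewrite expr2; apply: ler_pM; lra.
rewrite mul1r; apply: (le_trans h1).
rewrite [N ^+ 3]exprS -mulrA mulrCA; apply: ler_peMr; first by rewrite exprn_ge0// ltW.
by nra.
Qed.

(** The bounds on the digits at n + 1 keep the next tails away from 0, so that the numbers cannot
    approach a common endpoint of neighbouring cylinders. The 4 is 2 * 2: as r_n x_n <= 1, each
    product of tail values is at least 1 / (2 q_n), with the same q_n for both numbers. *)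
Lemma cfrac_value_sep a b n M : (forall i, (0 < a i)%N) -> (forall i, (0 < b i)%N) ->
  (forall i, (i < n)%N -> a i = b i) -> a n <> b n ->
  (a n <= M)%N -> (b n <= M)%N -> (a n.+1 <= M)%N -> (b n.+1 <= M)%N ->
  (cfrac_denom a n ^+ 2)^-1 <=
    4 * M.+1%:R ^+ 3 * `|cfrac_value a - cfrac_value b|.
Proof.
move=> a0 b0 ab nab aM bM aM1 bM1.
have /andP[ra0 ra1] := denom_ratio01 n a0.
have /andP[va0 va1] := @cfrac_value01 R (tail a n.+1) (fun i => a0 _).
have /andP[vb0 vb1] := @cfrac_value01 R (tail b n.+1) (fun i => b0 _).
have low c : (forall i, (0 < c i)%N) -> (c n.+1 <= M)%N ->
    M.+1%:R^-1 <= cfrac_value (tail c n.+1) :> R.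
  move=> c0 cM; rewrite cfrac_value_tail//.
  have /andP[? ?] := @cfrac_value01 R (tail c n.+2) (fun i => c0 _).
  have ? : (c n.+1)%:R + 1 <= M.+1%:R :> R by rewrite natr1 ler_nat.
  have ? : 0 <= (c n.+1)%:R :> R by [].
  by rewrite lef_pV2 ?posrE; lra.
have tails : 1 <= M.+1%:R ^+ 3 * `|cfrac_value (tail a n) - cfrac_value (tail b n)| :> R.
  rewrite cfrac_value_tail// [X in _ - X]cfrac_value_tail//.
  have M0 : 0 <= M.+1%:R ^+ 3 :> R by rewrite exprn_ge0.
  have [abn|abn|//] := ltngtP (a n) (b n).
    apply: le_trans (ler_wpM2l M0 (ler_norm _)).
    by apply: invr_gap => //; [rewrite !ltW|exact: low|exact: ltW].
  rewrite distrC; apply: le_trans (ler_wpM2l M0 (ler_norm _)).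
  by apply: invr_gap => //; [rewrite !ltW|exact: low|exact: ltW].
have qE : cfrac_denom b n = cfrac_denom a n /\ denom_ratio b n = denom_ratio a n.
  elim: n ab {nab aM bM aM1 bM1 ra0 ra1 va0 va1 vb0 vb1 low tails} => [|m IH] ab //.
  have [|e1 e2] := IH; first by move=> i im; apply: ab; rewrite ltnS ltnW.
  by rewrite /= e1 e2 ab.
have pa := cfrac_denom_prod n a0; have pb := cfrac_denom_prod n b0.
rewrite (cfrac_value_dist a0 b0 ab); case: qE pb => -> ->.
have /andP[wa0 wa1] := @cfrac_value01 R (tail a n) (fun i => a0 _).
have /andP[wb0 wb1] := @cfrac_value01 R (tail b n) (fun i => b0 _).
have := cfrac_denom_gt0 n a0; move: tails ra0 ra1 wa0 wa1 wb0 wb1 pa.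
move: (\prod_(i < n) _) (\prod_(i < n) _) => P Q.
move: (cfrac_value (tail a n)) (cfrac_value (tail b n)) => X Y.
move: `|X - Y| => d; move: (cfrac_denom a n) (denom_ratio a n) => q r.
move=> dM r0 r1 X0 X1 Y0 Y1 PE q0 QE.
have half z Z : 0 < Z -> Z < 1 -> z * (q * (1 + r * Z)) = 1 -> q^-1 <= 2 * z.
  move=> Z0 Z1 zE; have rZ0 : 0 <= r * Z by apply: mulr_ge0 => //; exact: ltW.
  have rZ1 : r * Z <= 1 by nra.
  have p0 : 0 < q * (1 + r * Z) by apply: mulr_gt0 => //; lra.
  have z0 : 0 < z by rewrite -(pmulr_lgt0 _ p0) zE.
  rewrite -[_^-1]mulr1 ler_pdivrMl// -[leLHS]zE.
  have zq : 0 < z * q by rewrite mulr_gt0.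
  by move: (r * Z) rZ0 rZ1 => e ? ?; nra.
have hP := half _ _ X0 X1 PE; have hQ := half _ _ Y0 Y1 QE.
have qV : 0 < q^-1 by rewrite invr_gt0.
rewrite -exprVn expr2.
apply: (@le_trans _ _ ((2 * P) * (2 * Q))); first by apply: ler_pM => //; lra.
have PQ : 0 <= P * Q by apply: mulr_ge0; lra.
move: {hP hQ} (_ ^+ 3) dM => N dM.
by have := ler_wpM2r PQ dM; lra.
Qed.

End Denominators.

(** * Coding of [0, 1) by admissible digit sequences, and the mass of cylinders *)

Section Coding.
Context {R : realType} (M : nat) (f : nat -> nat).
Implicit Types (a : nat -> nat) (r t u : R).

(* The cylinder obtained by appending the digit [i] occupies the proportion
   [(1 + r) / ((i + r) (i + 1 + r))] of a cylinder with [r = q_(n-1) / q_n];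
   [cum r j] sums these proportions over [1 <= i <= j], normalised so that
   [cum r M = 1]. *)
Definition cum r j : R := j%:R * (M.+1%:R + r) / (M%:R * (j.+1%:R + r)).

Definition digit r t : nat := find (fun j => t < cum r j) (iota 0 M.+1).

(* [f n = 0] leaves the digit [n] free in [1..M]; otherwise [f n] prescribes it. *)
Definition admissible a :=
  forall n, if f n == 0 then (0 < a n <= M)%N else a n == f n.

(** The state consists of the position of t in its current interval, rescaled to [0, 1), and of
    q_(n-1) / q_n. A free digit selects a subinterval and rescales; a prescribed digit consumes
    nothing of t. *)
Fixpoint code t n : R * R :=
  if n is m.+1 then
    let: (u, r) := code t m in
    if f m == 0 then
      let j := digit r u in
      ((u - cum r j.-1) / (cum r j - cum r j.-1), (j%:R + r)^-1)
    else (u, ((f m)%:R + r)^-1)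
  else (t, 0).

Definition code_digit t n : nat :=
  if f n == 0 then digit (code t n).2 (code t n).1 else f n.

Definition weight a n : R :=
  if f n == 0 then
    cum (denom_ratio a n) (a n) - cum (denom_ratio a n) (a n).-1
  else 1.

(** For admissible [a] this is the length of the interval of those t whose code starts with the
    first n digits of [a]. *)
Definition mass a n : R := \prod_(i < n) weight a i.

Hypothesis M0 : (0 < M)%N.

Lemma admissible_gt0 a : admissible a -> forall n, (0 < a n)%N.
Proof. by move=> aa n; have := aa n; case: (posnP (f n)) => [_ /andP[]|? /eqP->]. Qed.

Lemma digitP r t : 0 <= r -> 0 <= t < 1 ->
  (0 < digit r t <= M)%N /\ cum r (digit r t).-1 <= t < cum r (digit r t).
Proof.
move=> r0 /andP[t0 t1].
have cM : cum r M = 1.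
  have ? : 1 <= M%:R :> R by rewrite ler1n.
  have ? : 1 <= M.+1%:R :> R by rewrite ler1n.
  by rewrite /cum divff// mulf_neq0// gt_eqF//; lra.
have hs : has (fun j => t < cum r j) (iota 0 M.+1).
  by apply/hasP; exists M; rewrite ?mem_iota//= cM.
have dM : (digit r t <= M)%N by rewrite -ltnS -(size_iota 0 M.+1) -has_find.
have := nth_find 0 hs; rewrite -/(digit r t) nth_iota// add0n => td.
have d0 : (0 < digit r t)%N.
  by rewrite lt0n; apply: contraTneq td => ->; rewrite /cum !mul0r -leNgt.
rewrite d0 dM td andbT; split=> //; rewrite leNgt.
have dl : ((digit r t).-1 < digit r t)%N by rewrite prednK.
have := before_find 0 dl; rewrite nth_iota ?add0n => [->//|].
by rewrite (leq_trans dl)// (leq_trans dM).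
Qed.

Lemma code_ratio t n : (code t n).2 = denom_ratio (code_digit t) n.
Proof.
elim: n => [|n IH] //=; rewrite -IH /code_digit; case: (code t n) => u r/=.
by case: (f n == 0%N).
Qed.

Lemma code_bounds t n : 0 <= t < 1 -> 0 <= (code t n).1 < 1 /\ 0 <= (code t n).2.
Proof.
move=> t01; elim: n => [|n]//=.
case: (code t n) => u r /= [u01 r0]; case: ifPn => _ /=; last first.
  by rewrite invr_ge0 addr_ge0.
have [_ /andP[c0 c1]] := digitP r0 u01.
rewrite invr_ge0 addr_ge0// ltr_pdivrMr; last by lra.
by rewrite mul1r divr_ge0//; lra.
Qed.

Lemma code_digit_admissible t : 0 <= t < 1 -> admissible (code_digit t).
Proof.
move=> t01 n; rewrite /code_digit; case: (f n == 0%N); last exact: eqxx.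
by have [t01n r0] := code_bounds n t01; have [] := digitP r0 t01n.
Qed.

(** As long as the digits agree, both positions undergo the same affine rescalings, so t - u is the
    mass times the difference of two positions in [0, 1). *)
Lemma code_dist t u n : 0 <= t < 1 -> 0 <= u < 1 ->
  (forall i, (i < n)%N -> code_digit t i = code_digit u i) ->
  `|t - u| <= mass (code_digit t) n.
Proof.
move=> t01 u01 tu.
suff [m0 [_ tuE]] : 0 <= mass (code_digit t) n /\ (code t n).2 = (code u n).2 /\
    t - u = mass (code_digit t) n * ((code t n).1 - (code u n).1).
  rewrite tuE normrM ger0_norm//; apply: ler_piMr => //.
  have [/andP[? ?] _] := code_bounds n t01; have [/andP[? ?] _] := code_bounds n u01.
  by rewrite ler_norml; lra.
elim: n tu => [|n IH] tu; first by rewrite /mass big_ord0 mul1r; split.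
have [|m0 [r_eq tuE]] := IH; first by move=> i ni; apply: tu; rewrite ltnS ltnW.
rewrite /mass big_ord_recr/= -/(mass _ n) tuE /weight -code_ratio.
have := tu n (leqnn _); rewrite /code_digit.
have [t01n r0] := code_bounds n t01; have [u01n _] := code_bounds n u01.
case: (code t n) (code u n) r_eq t01n r0 u01n => [t' r] [u' r'] /= <- {r'} t01n r0 u01n.
case: ifPn => /= [_ dE|_ _]; last by rewrite mulr1.
have [_ /andP[]] := digitP r0 t01n; rewrite -dE => c0 c1.
split; first by rewrite mulr_ge0//; lra.
split=> //.
rewrite -mulrA; congr (_ * _).
by field; rewrite subr_eq0 gt_eqF//; lra.
Qed.

(** The induction carries the extra factor 1 + r_n because 1 / (q_n^2 (1 + r_n)) is the Lebesgue
    length of the cylinder. The ratio of mass to length then grows at a free digit by exactly 1 + (1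
    + r_n) / M, and at a prescribed digit F by (F + r_n) (F + 1 + r_n) / (1 + r_n) <= (F + 1)^2. *)
Lemma mass_bound a n : admissible a ->
  mass a n * cfrac_denom a n ^+ 2 <=
    (1 + 2 / M%:R) ^+ n * \prod_(i < n) (f i).+1%:R ^+ 2.
Proof.
move=> aa; have a0 := admissible_gt0 aa.
have M1 : 1 <= M%:R :> R by rewrite ler1n.
have MV0 : 0 < M%:R^-1 :> R by rewrite invr_gt0; lra.
suff [m0 H] : 0 <= mass a n /\
    mass a n * cfrac_denom a n ^+ 2 * (1 + denom_ratio a n) <=
    (1 + 2 / M%:R) ^+ n * \prod_(i < n) (f i).+1%:R ^+ 2.
  apply: le_trans H; have /andP[? ?] := denom_ratio01 (R := R) n a0.
  by apply: ler_peMr; [rewrite mulr_ge0 ?sqr_ge0|lra].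
elim: n => [|n [m0 IH]]; first by rewrite /mass !big_ord0/= !expr1n addr0 !mulr1.
rewrite /mass !big_ord_recr/= -/(mass a n) [_ ^+ n.+1]exprSr.
set P := \prod_(i < n) _ in IH *.
rewrite [X in _ /\ _ <= X]mulrACA.
have /andP[r0 r1] := denom_ratio01 (R := R) n a0.
have A1 : 1 <= (a n)%:R :> R by rewrite ler1n.
have q0 := cfrac_denom_gt0 (R := R) n a0.
have : admissible a by []; move=> /(_ n); rewrite /weight.
move: (denom_ratio a n) (cfrac_denom a n) r0 r1 q0 IH => r q r0 r1 q0 IH.
case: ifPn => [/eqP fn _|fn an].
- rewrite fn expr1n !mulr1.
  set w := cum r (a n) - _.
  have wE : w =
      (1 + r) * (1 + (1 + r) / M%:R) / (((a n)%:R + r) * ((a n)%:R + r + 1)).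
    rewrite /w /cum prednK ?a0// -[M.+1%:R]natr1 -[(a n).+1%:R]natr1.
    rewrite (_ : (a n).-1%:R = (a n)%:R - 1); last by rewrite -subn1 natrB ?a0.
    by field; rewrite !gt_eqF//; lra.
  have w0 : 0 <= w.
    by rewrite wE divr_ge0 ?mulr_ge0 ?addr_ge0 ?divr_ge0//; lra.
  split; first exact: mulr_ge0.
  rewrite (_ : mass a n * w * _ * _ =
    mass a n * q ^+ 2 * (1 + r) * (1 + (1 + r) / M%:R)); last first.
    by rewrite wE; field; rewrite !gt_eqF//; lra.
  apply: ler_pM => //; first by rewrite !mulr_ge0 ?sqr_ge0//; lra.
    by rewrite addr_ge0// divr_ge0//; lra.
  by rewrite lerD2l ler_pM2r//; lra.
- rewrite mulr1 (eqP an); split=> //.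
  have F1 : 1 <= (f n)%:R :> R by rewrite ler1n lt0n.
  rewrite (_ : mass a n * _ * _ = mass a n * q ^+ 2 * (1 + r) *
     (((f n)%:R + r) * ((f n)%:R + 1 + r) / (1 + r))); last first.
    by field; rewrite !gt_eqF//; lra.
  apply: ler_pM => //.
  + by rewrite !mulr_ge0 ?sqr_ge0//; lra.
  + by rewrite divr_ge0// ?mulr_ge0//; lra.
  rewrite ler_pdivrMr; last by lra.
  rewrite -[(f n).+1%:R]natr1; move: (f n)%:R F1 MV0 => F F1; move: (M%:R^-1) => MV MV0.
  apply: (@le_trans _ _ ((F + 1) ^+ 2 * (1 + r))); first by nra.
  by apply: ler_wpM2r; [lra|apply: ler_peMl; [exact: sqr_ge0|lra]].
Qed.

End Coding.

(** * Bounds on Hausdorff measure and dimension *)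

Section HausdorffBounds.
Context {R : realType}.
Implicit Types (A U : set R) (s C t u : R).

Lemma dist_le_diam U x y : U x -> U y -> (`|x - y|%:E <= diam U)%E.
Proof. by move=> Ux Uy; apply: ereal_sup_ubound; exists (x, y). Qed.

Lemma diam_ge0 U x : U x -> (0 <= diam U)%E.
Proof. by move=> Ux; have := dist_le_diam Ux Ux; rewrite subrr normr0. Qed.

Lemma diam_pow_ge0 s U : (0 <= diam_pow s U)%E.
Proof. by rewrite /diam_pow; case: ifP => // _; exact: poweR_ge0. Qed.

Lemma hausdorff_content_ge0 s delta A : (0 <= hausdorff_content s delta A)%E.
Proof.
apply: le_ereal_inf_tmp => _ [U _ <-].
by apply: nneseries_ge0 => i _ _; exact: diam_pow_ge0.
Qed.

(** The parameters t with x(t) in U_i are within C |U_i|^s of any one of them, so they lie in an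
    interval of length 2 C |U_i|^s. Such intervals cover [0, 1), and subadditivity of Lebesgue
    measure concludes. Using intervals instead of preimages avoids any measurability of [x]. *)
Lemma hausdorff_content_coding s A C (x : R -> R) : 0 <= s -> 0 < C ->
  (forall t, 0 <= t < 1 -> A (x t)) ->
  (forall t u, 0 <= t < 1 -> 0 <= u < 1 ->
     `|t - u| <= C * `|x t - x u| `^ s) ->
  ((2 * C)^-1%:E <= hausdorff_content s 1 A)%E.
Proof.
move=> s0 C0 Ax xdist; apply: le_ereal_inf_tmp => _ [U [AU U1] <-].
(* The scale delta = 1 rules out infinite diameters, so the powers are real numbers. *)
have rE i : exists r, 0 <= r /\ diam_pow s (U i) = r%:E /\
    (forall y z, U i y -> U i z -> `|y - z| `^ s <= r).
  rewrite /diam_pow; case: eqP => [->|/eqP/set0P[y0 Uy]]; first by exists 0.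
  have d0 := diam_ge0 Uy.
  have := U1 i; case: (diam (U i)) d0 (@dist_le_diam (U i)) => [d| |] // d0 dU _.
  exists (d `^ s); rewrite powR_ge0; split=> //; split=> // y z Uiy Uiz.
  by apply: ge0_ler_powR => //; have := dU _ _ Uiy Uiz; rewrite ?nnegrE ?lee_fin.
have [r rP] := choice rE.
pose V i : set R := [set t | 0 <= t < 1 /\ U i (x t)].
(* If [V i] is empty the centre is 0, and [J i] has nothing to contain. *)
pose c i := xget 0 (V i).
pose J i := `[c i - C * r i, c i + C * r i].
have VJ i : V i `<=` [set` J i].
  move=> t Vt; have [c01 Uc] : V i (c i) by rewrite /c; exact: xgetPex (ex_intro _ t Vt).
  have [t01 Ut] := Vt; have [_ [_ /(_ _ _ Ut Uc) h]] := rP i.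
  have := le_trans (xdist _ _ t01 c01) (ler_wpM2l (ltW C0) h).
  by rewrite /J /= in_itv/= ler_norml; lra.
have JE i : lebesgue_measure [set` J i] = ((2 * C)%:E * diam_pow s (U i))%E.
  have [r0 [-> _]] := rP i; rewrite lebesgue_measure_itv/= lte_fin.
  have Cr : 0 <= C * r i by rewrite mulr_ge0// ltW.
  case: ifPn => [_|]; first by rewrite -EFinB -EFinM; congr EFin; ring.
  by rewrite -leNgt -EFinM => h; congr EFin; lra.
have cover : `[0, 1[ `<=` \bigcup_i [set` J i].
  move=> t /=; rewrite in_itv/= => t01; have [i _ Ui] := AU _ (Ax _ t01).
  by exists i => //; apply: VJ.
have : (1 <= \sum_(i <oo) (2 * C)%:E * diam_pow s (U i))%E.
  have -> : (1 = lebesgue_measure (`[0%R, 1%R[ : set R))%E.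
    by rewrite lebesgue_measure_itv/= lte_fin ltr01 sube0.
  under eq_eseriesr do rewrite -JE.
  apply: (measure_sigma_subadditive lebesgue_measure) => //.
rewrite nneseriesZl; last by move=> *; exact: diam_pow_ge0.
have C2 : 0 < 2 * C by lra.
by rewrite -lee_pdivrMl// mule1.
Qed.

Lemma hausdorff_measure_coding s A C (x : R -> R) : 0 <= s -> 0 < C ->
  (forall t, 0 <= t < 1 -> A (x t)) ->
  (forall t u, 0 <= t < 1 -> 0 <= u < 1 ->
     `|t - u| <= C * `|x t - x u| `^ s) ->
  hausdorff_measure s A != 0%E.
Proof.
move=> s0 C0 Ax xdist; rewrite gt_eqF//.
apply: (@lt_le_trans _ _ (hausdorff_content s 1 A)); last first.
  by apply: ereal_sup_ubound; exists 1 => //; exact: ltr01.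
apply: lt_le_trans (hausdorff_content_coding s0 C0 Ax xdist).
by rewrite lte_fin invr_gt0; lra.
Qed.

Lemma hausdorff_dim_le1 A : A `<=` `[0, 1] -> (hausdorff_dim A <= 1)%E.
Proof.
move=> A01; apply/lee_addgt0Pr => e e0; rewrite -EFinD.
apply: ereal_inf_lbound; exists (1 + e) => //; split; first by lra.
have content0 d : 0 < d -> hausdorff_content (1 + e) d A = 0%E.
  move=> d0; apply/eqP; rewrite eq_le hausdorff_content_ge0 andbT.
  apply/lee_addgt0Pr => g g0; rewrite add0e.
  (* With 1/N <= h, the diameters are at most d, and the sum N (1/N)^(1+e) = N^(-e) is at most g
     because 1/N <= g^(1/e). *)
  pose h := Num.min d (Num.min 1 (g `^ (e^-1))).
  have h0 : 0 < h by rewrite !lt_min d0 ltr01 powR_gt0.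
  pose N := (Num.truncn h^-1).+1.
  have N0 : 0 < N%:R :> R by rewrite ltr0n.
  have Nh : N%:R^-1 <= h.
    by rewrite -[leRHS]invrK lef_pV2 ?posrE ?invr_gt0// ltW// truncnS_gt.
  pose U i : set R := if (i < N)%N then [set` `[i%:R / N%:R, i.+1%:R / N%:R]] else set0.
  have diamU i : (diam (U i) <= N%:R^-1%:E)%E.
    apply: ge_ereal_sup => _ [[y z] [/= Uy Uz] <-].
    move: Uy Uz; rewrite /U; case: ifP => // _.
    rewrite /= !in_itv/= lee_fin -natr1 mulrDl mul1r ler_norml.
    by move=> /andP[? ?] /andP[? ?]; apply/andP; split; lra.
  apply: (@le_trans _ _ (\sum_(i <oo) diam_pow (1 + e) (U i))%E).
    apply: ereal_inf_lbound; exists U => //; split.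
      move=> y /A01; rewrite /= in_itv/= => /andP[y0 y1].
      (* At y = 1 the truncation of y N is N, out of range; the last interval contains this
         point. *)
      have [y1'|y1'] := eqVneq y 1.
        exists N.-1 => //; rewrite /U ltnS leqnn/= in_itv/= y1'.
        by rewrite divff ?gt_eqF// ler_pdivrMr// mul1r lexx ler_nat leqnSn.
      have yN0 : 0 <= y * N%:R by rewrite mulr_ge0// ltW.
      exists (Num.truncn (y * N%:R)) => //; have /andP[t1 t2] := truncn_itv yN0.
      have -> : (U (Num.truncn (y * N%:R)) =
          [set` `[(Num.truncn (y * N%:R))%:R / N%:R,
                  (Num.truncn (y * N%:R)).+1%:R / N%:R]]).
        rewrite /U ifT// -(ltr_nat R); apply: le_lt_trans t1 _.
        by rewrite gtr_pMl// lt_neqAle y1' y1.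
      by rewrite /= in_itv/= ler_pdivrMr// ler_pdivlMr// t1 ltW.
    by move=> i; apply: le_trans (diamU i) _; rewrite lee_fin (le_trans Nh)// ge_min lexx.
  rewrite (nneseries_split 0 N); last by move=> *; exact: diam_pow_ge0.
  rewrite add0n [X in (_ + X)%E]eseries0 ?adde0; last first.
    by move=> i Ni _; rewrite /U ltnNge Ni/= /diam_pow eqxx.
  have term i : (diam_pow (1 + e) (U i) <= (N%:R^-1 `^ (1 + e))%:E)%E.
    rewrite /diam_pow; case: eqP => [_|/eqP/set0P[y0 Uy]].
      by rewrite lee_fin powR_ge0.
    have := diam_ge0 Uy.
    have := diamU i; case: (diam (U i)) => [w| |] //; rewrite !lee_fin => wN w0.
    by apply: ge0_ler_powR => //; rewrite ?nnegrE//; lra.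
  apply: (@le_trans _ _ (\sum_(0 <= i < N) (N%:R^-1 `^ (1 + e))%:E)%E).
    by apply: lee_sum => i _; exact: term.
  rewrite sumEFin lee_fin big_const_nat subn0 iter_addr_0.
  rewrite powRD; last by apply/implyP => _; rewrite invr_eq0 gt_eqF.
  rewrite powRr1 ?invr_ge0// -[leLHS]mulr_natl mulrA divff ?gt_eqF// mul1r.
  apply: (@le_trans _ _ ((g `^ e^-1) `^ e)); last first.
    by rewrite -powRrM mulVf ?gt_eqF// powRr1// ltW.
  apply: ge0_ler_powR; rewrite ?nnegrE ?invr_ge0 ?powR_ge0//; first exact: ltW.
  by rewrite (le_trans Nh)// !ge_min lexx !orbT.
apply/eqP; rewrite eq_le; apply/andP; split.
  by apply: ge_ereal_sup => _ [d d0 <-]; rewrite content0.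
rewrite -(content0 1)//; apply: ereal_sup_ubound; exists 1 => //; exact: ltr01.
Qed.

End HausdorffBounds.

(** * Hausdorff measure of sets containing all numbers with admissible digits *)

Lemma powR_gt1 (R : realType) (a x : R) : 1 < a -> 0 < x -> 1 < a `^ x.
Proof.
by move=> a1 x0; rewrite /powR gt_eqF ?(lt_trans ltr01)// expR_gt1 mulr_gt0// ln_gt0.
Qed.

Section CodedSetDimension.
Context {R : realType} (f : nat -> nat).
Implicit Types (s theta C : R) (a b : nat -> nat).

(* Every free digit is followed by a free or a unit digit, which keeps numbers
   that first differ at a free digit well apart. *)
Hypothesis f_sep : forall n, f n = 0%N -> (f n.+1 <= 1)%N.
Hypothesis f_subexp : forall theta : R, 1 < theta ->
  exists C, forall n, \prod_(i < n) (f i).+1%:R ^+ 2 <= C * theta ^+ n.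

Lemma admissible_leM M a b n : (0 < M)%N -> admissible M f a ->
  admissible M f b -> a n <> b n -> [/\ (a n <= M)%N, (b n <= M)%N,
  (a n.+1 <= M)%N & (b n.+1 <= M)%N].
Proof.
move=> M0 aa ab nab; have fn : f n = 0%N.
  apply: contrapT => /eqP/negbTE fn; apply: nab.
  by have := aa n; have := ab n; rewrite fn => /eqP -> /eqP ->.
have leS c : admissible M f c -> (c n.+1 <= M)%N.
  move=> /(_ n.+1); have := f_sep fn; case: (f n.+1) => [|[|//]] _ /=.
    by case/andP.
  by move=> /eqP ->.
have := aa n; have := ab n; rewrite fn eqxx => /andP[_ ?] /andP[_ ?].
by split=> //; exact: leS.
Qed.

(** The loss theta^2 = 2^(1-s) per digit is split evenly: one theta bounds 1 + 2/M, the other the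
    prescribed digits. With z = q_n^(-2) and z 2^n <= 2, the total loss is absorbed by giving up
    z^(1-s), at the price of the constant 2^(1-s). *)
Lemma mass_denom_bound s : 0 < s < 1 ->
  exists M C, [/\ (0 < M)%N, 0 < C & forall a n, admissible M f a ->
    mass M f a n <= C * ((cfrac_denom a n ^+ 2)^-1 : R) `^ s].
Proof.
move=> /andP[s0 s1]; pose delta : R := 2 `^ (1 - s).
have delta1 : 1 < delta.
  by apply: powR_gt1; [rewrite ltr1n|rewrite subr_gt0].
pose theta := delta `^ 2^-1.
have theta1 : 1 < theta.
  by apply: powR_gt1; rewrite // invr_gt0.
have thetaE : theta ^+ 2 = delta.
  by rewrite -powR_mulrn ?powR_ge0// -powRrM mulVf// powRr1//; lra.
have [C fC] := f_subexp theta1.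
have C1 : 1 <= C by have := fC 0%N; rewrite big_ord0 expr0 mulr1.
have [M M0 Mtheta] : exists2 M, (0 < M)%N & 1 + 2 / M%:R <= theta.
  exists (Num.truncn (2 / (theta - 1))).+1 => //.
  have := truncnS_gt (2 / (theta - 1)); rewrite ltr_pdivrMr ?subr_gt0//.
  move: (_.+1%:R) (ltr0Sn R (Num.truncn (2 / (theta - 1)))) => m m0 h.
  by rewrite -lerBrDl ler_pdivrMr//; lra.
exists M, (C * delta); split=> //; first by rewrite mulr_gt0; lra.
move=> a n aa; have a0 := admissible_gt0 aa.
have q0 := cfrac_denom_gt0 (R := R) n a0.
have z0 : 0 < cfrac_denom a n ^+ 2 :> R by rewrite exprn_gt0.
have := mass_bound (R := R) M0 n aa.
rewrite -ler_pdivlMr// => /le_trans; apply.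
have := cfrac_denom_ge (R := R) n a0.
rewrite -ler_pdivrMr//; set z := _^-1 => zn.
have {}z0 : 0 < z by rewrite invr_gt0.
have h1 : z `^ (1 - s) * delta ^+ n <= delta.
  have -> : delta ^+ n = (2 ^+ n) `^ (1 - s).
    by rewrite -(powR_mulrn n (powR_ge0 _ _)) -(powR_mulrn n (ler0n _ 2)) -!powRrM mulrC.
  rewrite -powRM ?exprn_ge0//; last exact: ltW.
  apply: ge0_ler_powR; rewrite ?nnegrE//; [lra| |].
    by rewrite mulr_ge0 ?exprn_ge0// ltW.
  by rewrite mulrC.
have zE : z = z `^ s * z `^ (1 - s).
  rewrite -powRD; first by rewrite addrC subrK powRr1// ltW.
  by apply/implyP => _; rewrite gt_eqF.
apply: (@le_trans _ _ (C * delta ^+ n * z)).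
  rewrite ler_pM2r// -thetaE -exprM mulnC exprM expr2 mulrCA.
  apply: ler_pM => //; rewrite ?exprn_ge0 ?prodr_ge0//.
  by apply: lerXn2r; rewrite ?nnegrE ?addr_ge0 ?divr_ge0 ?powR_ge0.
rewrite {1}zE [leLHS](_ : _ = C * (z `^ s * (z `^ (1 - s) * delta ^+ n))); last by ring.
rewrite -mulrA ler_pM2l; last by lra.
by rewrite mulrC ler_pM2r// powR_gt0.
Qed.

(** At the first index where the codes differ, |t - u| is at most the mass, hence at most C
    q_n^(-2s), and q_n^(-2) is controlled by the distance of the values. *)
Lemma code_holder s : 0 < s < 1 -> exists M C, [/\ (0 < M)%N, 0 < C &
  forall t u, 0 <= t < 1 -> 0 <= u < 1 -> `|t - u| <=
    C * `|cfrac_value (code_digit M f t) - cfrac_value (code_digit M f u)| `^ s].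
Proof.
move=> s01; have [M [C [M0 C0 massC]]] := mass_denom_bound s01.
have /andP[s0 s1] := s01.
pose K : R := 4 * M.+1%:R ^+ 3; have K0 : 0 < K by rewrite mulr_gt0// exprn_gt0.
exists M, (C * K `^ s); split=> //; first by rewrite mulr_gt0 ?powR_gt0.
move=> t u t01 u01.
have ta := code_digit_admissible f M0 t01; have ua := code_digit_admissible f M0 u01.
have t0 := admissible_gt0 ta; have u0 := admissible_gt0 ua.
have tail_le n : (forall i, (i < n)%N -> code_digit M f t i = code_digit M f u i) ->
    `|t - u| <= C * ((cfrac_denom (code_digit M f t) n ^+ 2)^-1) `^ s.
  by move=> tu; apply: le_trans (massC _ _ ta); exact: code_dist.
have [ex|nex] := pselect (exists n, code_digit M f t n != code_digit M f u n).
  case: (ex_minnP ex) => n /eqP tun nmin.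
  have tu i : (i < n)%N -> code_digit M f t i = code_digit M f u i.
    by move=> ni; apply/eqP; apply: contraTT ni => /nmin; rewrite -leqNgt.
  apply: le_trans (tail_le n tu) _; rewrite -mulrA ler_pM2l// -powRM//; last exact: ltW.
  have [? ? ? ?] := admissible_leM M0 ta ua tun.
  have sep := cfrac_value_sep (R := R) t0 u0 tu tun.
  apply: ge0_ler_powR; rewrite ?nnegrE ?invr_ge0 ?sqr_ge0//; [exact: ltW| |exact: sep].
  by rewrite mulr_ge0// ltW.
have tu n : code_digit M f t n = code_digit M f u n.
  by apply/eqP; apply: contrapT => /negP h; apply: nex; exists n.
(* Equal codes force t = u: the bound C q_n^(-2s) holds for every n, and q_n tends to infinity. *)
suff -> : `|t - u| = 0 by rewrite mulr_ge0 ?powR_ge0// mulr_ge0 ?powR_ge0// ltW.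
apply/eqP; rewrite eq_le normr_ge0 andbT leNgt; apply/negP => tu0.
have w0 : 0 < (`|t - u| / C) `^ s^-1 by rewrite powR_gt0// divr_gt0.
have geo : 2 * 2^-1 ^+ n @[n --> \oo] --> (0 : R).
  rewrite -[X in _ --> X](mulr0 2); apply: cvgMl_tmp.
  by apply: cvg_expr; rewrite ger0_norm; lra.
have [n _ /(_ n (leqnn n))/=] : \forall n \near \oo,
    2 * 2^-1 ^+ n < (`|t - u| / C) `^ s^-1 by apply: (cvgr_lt _ geo).
apply/negP; rewrite -leNgt.
have z0 : 0 < cfrac_denom (code_digit M f t) n ^+ 2 :> R.
  by rewrite exprn_gt0// cfrac_denom_gt0.
apply: (@le_trans _ _ ((cfrac_denom (code_digit M f t) n ^+ 2)^-1)); last first.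
  rewrite exprVn ler_pdivlMr ?exprn_gt0// mulrC ler_pdivrMr//.
  exact: cfrac_denom_ge.
rewrite -[leRHS]powRr1 ?invr_ge0 ?sqr_ge0//.
rewrite -[X in _ <= _ `^ X](mulfV (lt0r_neq0 s0)) powRrM.
apply: ge0_ler_powR; rewrite ?nnegrE ?invr_ge0 ?divr_ge0 ?powR_ge0//; [exact: ltW|exact: ltW|].
by rewrite ler_pdivrMr// mulrC; exact: tail_le.
Qed.

Lemma hausdorff_measure_cfrac s : 0 <= s < 1 -> exists2 M, (0 < M)%N &
  forall A : set R, (forall a, admissible M f a -> A (cfrac_value a)) ->
  hausdorff_measure s A != 0%E.
Proof.
(* The exponent (1 + s) / 2 is positive even for s = 0. Distances being at most 1, the estimate
   passes down to the exponent s. *)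
move=> /andP[s0 s1]; have s01 : 0 < (1 + s) / 2 < 1 by apply/andP; split; lra.
have [M [C [M0 C0 H]]] := code_holder s01.
exists M => // A Aa.
apply: (@hausdorff_measure_coding _ s A C (fun t => cfrac_value (code_digit M f t))) => //.
  by move=> t t01; apply: Aa; exact: code_digit_admissible.
move=> t u t01 u01; apply: le_trans (H t u t01 u01) _; rewrite ler_pM2l//.
set x := cfrac_value _; set y := cfrac_value _.
have [->|d0] := eqVneq (`|x - y|) 0.
  rewrite powR0; last by rewrite gt_eqF//; lra.
  exact: powR_ge0.
have /andP[? ?] := @cfrac_value01 R _ (admissible_gt0 (code_digit_admissible f M0 t01)).
have /andP[? ?] := @cfrac_value01 R _ (admissible_gt0 (code_digit_admissible f M0 u01)).
apply: ger_powR; last by lra.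
by rewrite lt_neqAle eq_sym d0 normr_ge0/= /x /y ler_norml; lra.
Qed.

End CodedSetDimension.

(** * Choice of the large digits from the growth function *)

Lemma cvg_powR_oppr0 (R : realType) (f : nat -> R) (c : R) : 0 < c ->
  f n @[n --> \oo] --> +oo -> f n `^ (- c) @[n --> \oo] --> (0 : R).
Proof.
move=> c0 foo; rewrite (_ : (fun n => _) = fun n => (f n `^ c)^-1); last first.
  by apply/funext => n; rewrite powRN.
have fc : f n `^ c @[n --> \oo] --> +oo.
  apply/cvgryPge => A; near=> n.
  have fA : `|A| `^ c^-1 <= f n by near: n; move/cvgryPge : foo; apply.
  apply: (le_trans (ler_norm A)); rewrite -[leLHS]powRr1// -(mulVf (lt0r_neq0 c0)).
  rewrite powRrM; apply: ge0_ler_powR; rewrite ?nnegrE ?powR_ge0//; first exact: ltW.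
  exact: le_trans (powR_ge0 _ _) fA.
apply/gtr0_cvgV0 => //.
by move/cvgryPgt : fc; apply.
Unshelve. all: by end_near. Qed.

Section DigitProfile.
Context {R : realType} (psi : nat -> R) (beta : R).
Hypothesis psi_gt0 : forall n, 0 < psi n.
Hypothesis psi_incr : forall m n, (m <= n)%N -> psi m <= psi n.
Hypothesis psi_superlinear : n%:R / psi n @[n --> \oo] --> (0 : R).
Hypothesis beta_gt0 : 0 < beta.
Hypothesis beta_lt : beta < 2^-1.

(* The growth exponent beta < 1/2 leaves room for some p > 1 with
   beta (p + 1) < 1. Rounding [L ^ p] down to an integer moves [expR L] by a
   factor tending to 1, and the rounded value takes at most [L ^ p + 1] values
   up to the current one. *)
Let p : R := (2 * beta)^-1.
Let L j : R := ln (1 + psi (j * 3)%N).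
Let level j : nat := Num.truncn (L j `^ p).
Let h j : R := (level j)%:R `^ p^-1.
(** The half accounts for each large digit entering two products. *)
Let target j : nat := Num.truncn (expR (h j) / 2).

(** The successor keeps digits positive. Where [level] stands still the digit is 1, which later
    marks a block of free digits. *)
Definition big_digit j : nat := (target j.+1 - target j).+1.

Let p_gt1 : 1 < p.
Proof.
by move: beta_lt beta_gt0 => ? ?; rewrite /p invf_gt1; lra.
Qed.

Let p_gt0 : 0 < p. Proof. exact: lt_trans p_gt1. Qed.

Let L_gt0 j : 0 < L j.
Proof. by rewrite /L ln_gt0// ltrDl. Qed.

Let L_le i j : (i <= j)%N -> L i <= L j.
Proof.
by move=> ij; rewrite /L ler_ln ?posrE ?addr_gt0// lerD2l psi_incr// leq_mul2r.
Qed.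

Let expRL j : expR (L j) = 1 + psi (j * 3)%N.
Proof. by rewrite /L lnK// posrE addr_gt0. Qed.

Let level_le i j : (i <= j)%N -> (level i <= level j)%N.
Proof.
move=> ij; rewrite /level; apply: le_truncn; apply: ge0_ler_powR; rewrite ?nnegrE.
- exact: ltW.
- exact: ltW.
- exact: ltW.
- exact: L_le.
Qed.

Let h_le i j : (i <= j)%N -> h i <= h j.
Proof.
move=> /level_le; rewrite -(ler_nat R) /h => lij.
have pV : 0 <= p^-1 by rewrite invr_ge0 ltW.
by apply: (ge0_ler_powR pV); rewrite ?nnegrE.
Qed.

Let target_le i j : (i <= j)%N -> (target i <= target j)%N.
Proof.
move=> /h_le; rewrite -ler_expR => hij; apply: le_truncn.
by rewrite ler_wpM2r.
Qed.

Let hL j : h j <= L j.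
Proof.
have Lp : (level j)%:R <= L j `^ p by rewrite /level truncn_le// powR_ge0.
rewrite -[leRHS]powRr1; last exact: ltW.
rewrite -(mulfV (lt0r_neq0 p_gt0)) powRrM.
have pV : 0 <= p^-1 by rewrite invr_ge0 ltW.
by apply: (ge0_ler_powR pV); rewrite ?nnegrE ?powR_ge0.
Qed.

(** Since h^p is the integer part of L^p and h <= L, one has (L - h) L^(p-1) <= L^p - h^p < 1. *)
Let hL_gap j : L j - h j <= L j `^ (- (p - 1)).
Proof.
have Lp : L j `^ p < (level j).+1%:R by rewrite /level truncnS_gt.
have hp : h j `^ p = (level j)%:R by rewrite /h -powRrM mulVf ?gt_eqF// powRr1.
have split y : 0 <= y -> y `^ p = y * y `^ (p - 1).
  move=> y0; rewrite -{1}[p](subrKC 1) [LHS]powRD ?powRr1//.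
  by rewrite subrKC gt_eqF.
have h0 : 0 <= h j := powR_ge0 _ _.
have hle : h j `^ (p - 1) <= L j `^ (p - 1).
  have p10 : 0 <= p - 1 by rewrite subr_ge0 ltW.
  by apply: (ge0_ler_powR p10); rewrite ?nnegrE ?hL ?(ltW (L_gt0 j)).
have Lp0 : 0 < L j `^ (p - 1) by rewrite powR_gt0.
rewrite powRN -[leRHS]mul1r ler_pdivlMr// mulrBl -split; last exact: ltW.
have := ler_wpM2l h0 hle; rewrite -split// hp; rewrite -natr1 in Lp; lra.
Qed.

Let psi_oo : psi n @[n --> \oo] --> +oo.
Proof.
apply/cvgryPge => A; near=> n.
have An : A <= n%:R by near: n; exact: nbhs_infty_ger.
have : n%:R / psi n < 1 by near: n; apply: (cvgr_lt _ psi_superlinear).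
by rewrite ltr_pdivrMr// mul1r => /ltW; exact: le_trans.
Unshelve. all: by end_near. Qed.

Let mul3_oo : (j * 3)%N @[j --> \oo] --> \oo.
Proof. exact: cvg_mulnr. Qed.

Let psi3_oo : psi (j * 3)%N @[j --> \oo] --> +oo.
Proof.
by apply: (@cvg_comp _ _ _ (fun j => j * 3)%N psi _ \oo);
  [exact: mul3_oo|exact: psi_oo].
Qed.

Let L_oo : L j @[j --> \oo] --> +oo.
Proof.
apply/cvgryPge => A; move/cvgryPge : psi3_oo => /(_ (expR A)) H.
near=> j; rewrite -ler_expR expRL.
have : expR A <= psi (j * 3)%N by near: j.
lra.
Unshelve. all: by end_near. Qed.

Lemma sum_big_digit J :
  ((\sum_(j < J) big_digit j) + target 0 = target J + J)%N.
Proof.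
elim: J => [|J IH]; first by rewrite big_ord0 add0n addn0.
rewrite big_ord_recr/= addnAC IH /big_digit.
by have := target_le (leqnSn J); lia.
Qed.

(** By [hL_gap] and p > 1 the difference h - L tends to 0, while exp L = 1 + psi and psi tends to
    infinity. *)
Let cvg_expRh : expR (h j) / psi (j * 3)%N @[j --> \oo] --> (1 : R).
Proof.
have hL0 : h j - L j @[j --> \oo] --> (0 : R).
  apply: (squeeze_cvgr (f := fun j => - (L j `^ (- (p - 1)))) (h := fun=> 0)).
  - near=> j; have := hL j; have := hL_gap j => ? ?.
    by apply/andP; split; lra.
  - rewrite -[X in _ --> X]oppr0; apply: cvgN; apply: cvg_powR_oppr0 => //.
    by rewrite subr_gt0.
  - exact: cvg_cst.
have eh : expR (h j - L j) @[j --> \oo] --> (1 : R).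
  rewrite -[X in _ --> X]expR0.
  by apply: (@cvg_comp _ _ _ (fun j => h j - L j) expR _ (nbhs (0 : R)));
    [exact: hL0|exact: continuous_expR].
have V0 : (psi (j * 3)%N)^-1 @[j --> \oo] --> (0 : R).
  by apply/gtr0_cvgV0 => //; near=> j.
rewrite (_ : (fun j => _) = fun j => expR (h j - L j) * (1 + (psi (j * 3)%N)^-1)).
  have V1 : 1 + (psi (j * 3)%N)^-1 @[j --> \oo] --> (1 : R).
    by rewrite -[X in _ --> X]addr0; apply: cvgD V0; exact: cvg_cst.
  by rewrite -[X in _ --> X]mulr1; exact: cvgM.
apply/funext => j; rewrite expRB expRL.
have := psi_gt0 (j * 3)%N => ?.
by field; rewrite !gt_eqF//; lra.
Unshelve. all: by end_near. Qed.

Lemma cvg_sum_big_digit :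
  (2 * \sum_(j < J) big_digit j)%:R / psi (J * 3)%N @[J --> \oo] --> (1 : R).
Proof.
rewrite (_ : (fun J => _) = fun J => expR (h J) / psi (J * 3)%N +
   ((2 * \sum_(j < J) big_digit j)%:R - expR (h J)) / psi (J * 3)%N); last first.
  by apply/funext => J; rewrite -mulrDl addrC subrK.
rewrite -[X in _ --> X]addr0; apply: cvgD => //.
(* Twice the sum is 2 target J - 2 target 0 + 2 J, and 2 target J is within 2 of exp (h J). For J >=
   1 the error is at most (2 target 0 + 4) J, which is negligible against psi. *)
pose c : R := 2 * (target 0)%:R + 4.
have b0 : c * ((J * 3)%N%:R / psi (J * 3)%N) @[J --> \oo] --> (0 : R).
  rewrite -[X in _ --> X](mulr0 c); apply: cvgM; first exact: cvg_cst.
  by apply: (@cvg_comp _ _ _ (fun j => j * 3)%N (fun n => n%:R / psi n) _ \oo);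
    [exact: mul3_oo|exact: psi_superlinear].
apply: (squeeze_cvgr (f := fun J => - (c * ((J * 3)%N%:R / psi (J * 3)%N))) _ _ b0).
  near=> J; rewrite -ler_norml normrM [X in _ * X]ger0_norm ?invr_ge0 ?(ltW (psi_gt0 _))//.
  rewrite mulrA ler_pM2r ?invr_gt0//.
  have J1 : 1 <= J%:R :> R by rewrite ler1n; near: J; exact: nbhs_infty_gt.
  have e0 : 0 <= expR (h J) / 2 by rewrite divr_ge0// expR_ge0.
  have /andP[t1 t2] := truncn_itv e0; rewrite -/(target J) -[(target J).+1%:R]natr1 in t1 t2.
  have := sum_big_digit J; rewrite /c {c b0}.
  move: (target J) t1 t2 (target 0) => tJ t1 t2 t0 sumE.
  have {}sumE : (\sum_(j < J) big_digit j)%:R + t0%:R = tJ%:R + J%:R :> R.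
    by rewrite -natrD sumE natrD.
  rewrite (natrM _ 2) (natrM _ J) ler_norml.
  have : 0 <= t0%:R :> R by [].
  move: (\sum_(j < J) _)%:R t0%:R tJ%:R J%:R (expR _) sumE t1 t2 J1.
  move=> S t x y e sumE t1 t2 J1 t00; have := ler_peMr t00 J1 => tJ1.
  by apply/andP; split; lra.
by rewrite -[X in _ --> X]oppr0; apply: cvgN.
Unshelve. all: by end_near. Qed.

(** A digit other than 1 requires [level] to rise by at least 1, and every digit below J is at most
    2 exp (L J). The increments of [level] thus count the large digits, and they telescope when
    summed. *)
Let ln_big_digit j J : (j < J)%N ->
  ln (big_digit j)%:R <= ((level j.+1)%:R - (level j)%:R) * (L J + 1).
Proof.
move=> jJ; have lj := level_le (leqnSn j).
have [e|ne] := eqVneq (level j.+1) (level j).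
  by rewrite e subrr mul0r /big_digit /target /h e subnn ln1.
have l1 : 1 <= (level j.+1)%:R - (level j)%:R :> R.
  by rewrite lerBrDr addrC natr1 ler_nat ltn_neqAle eq_sym ne.
have L0 := L_gt0 J.
apply: (@le_trans _ _ (L J + 1)); last by rewrite ler_peMl//; lra.
rewrite -ler_expR lnK ?posrE// expRD.
have e0 : 0 <= expR (h J) / 2 by rewrite divr_ge0// expR_ge0.
have /andP[t1 _] := truncn_itv e0; rewrite -/(target J) in t1.
have e1 : expR (h J) <= expR (L J) by rewrite ler_expR.
have e2 : 1 <= expR (L J) by rewrite -expR0 ler_expR ltW.
have e3 : 2 <= expR 1 :> R by have := expR_ge1Dx (1 : R); lra.
apply: (@le_trans _ _ (expR (L J) * 2)); last by rewrite ler_pM2l// expR_gt0.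
apply: (@le_trans _ _ ((target J).+1%:R)); last by rewrite -natr1; lra.
rewrite ler_nat /big_digit; move: (target_le jJ).
by move: (target j.+1) (target j) (target J) => x y z xz; exact: leq_trans (leq_subr _ _) xz.
Qed.

(** By telescoping the sum is at most level J (L J + 1) <= 2 y^(p+1) with y = K (3J)^beta. As beta
    (p + 1) = 1/2 + beta < 1, this is o(J); the 6 is that 2 times the 3 of 3J. *)
Lemma cvg_ln_big_digit (K : R) : 1 <= K ->
  (\forall n \near \oo, ln (1 + psi n) <= K * n%:R `^ beta) ->
  (\sum_(j < J) ln (big_digit j)%:R) / J%:R @[J --> \oo] --> (0 : R).
Proof.
move=> K_ge1 psi_growth; pose c : R := 6 * K `^ (p + 1).
have b0 : c * (J * 3)%N%:R `^ (- (2^-1 - beta)) @[J --> \oo] --> (0 : R).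
  rewrite -[X in _ --> X](mulr0 c); apply: cvgM; first exact: cvg_cst.
  apply: cvg_powR_oppr0; first by rewrite subr_gt0.
  by apply: (@cvg_comp _ _ _ (fun j => j * 3)%N (fun n => n%:R : R) _ \oo);
    [exact: mul3_oo|exact: cvgr_idn].
apply: (squeeze_cvgr (f := fun=> 0) _ (cvg_cst _) b0).
have growth3 : \forall J \near \oo, L J <= K * (J * 3)%N%:R `^ beta.
  exact: (mul3_oo psi_growth).
near=> J; have J0 : (0 < J)%N by near: J; exact: nbhs_infty_gt.
have JR : 0 < J%:R :> R by rewrite ltr0n.
have lnb0 j : 0 <= ln (big_digit j)%:R :> R by rewrite ln_ge0// ler1n.
rewrite divr_ge0 ?sumr_ge0//= ler_pdivrMr//.
have LJ : L J <= K * (J * 3)%N%:R `^ beta by near: J.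
apply: (@le_trans _ _ ((level J)%:R * (L J + 1))).
  apply: (@le_trans _ _ (\sum_(j < J) ((level j.+1)%:R - (level j)%:R) * (L J + 1))).
    by apply: ler_sum => j _; exact: ln_big_digit.
  rewrite -mulr_suml -(big_mkord xpredT (fun j => (level j.+1)%:R - (level j)%:R : R)).
  rewrite telescope_sumr// ler_pM2r; last by have := L_gt0 J; lra.
  by rewrite lerBlDr lerDl.
set y := K * _ in LJ.
have y1 : 1 <= y.
  rewrite /y -[leLHS]mulr1; apply: ler_pM => //.
  have n1 : 1 <= (J * 3)%N%:R :> R by rewrite ler1n muln_gt0 J0.
  by have := ler_powR n1 (ltW beta_gt0); rewrite powRr0.
have y0 : 0 < y := lt_le_trans ltr01 y1.
have Lp : (level J)%:R <= L J `^ p by rewrite /level truncn_le// powR_ge0.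
have L0 := L_gt0 J.
apply: (@le_trans _ _ (y `^ p * (y + y))).
  apply: ler_pM => //; [lra| |lra].
  apply: (le_trans Lp); apply: (ge0_ler_powR (ltW p_gt0)); rewrite ?nnegrE//.
    exact: ltW.
  exact: ltW.
have n0 : 0 < (J * 3)%N%:R :> R by rewrite ltr0n muln_gt0 J0.
have yE : y `^ p * y =
    K `^ (p + 1) * ((J * 3)%N%:R `^ (- (2^-1 - beta)) * (J * 3)%N%:R).
  rewrite -{2}(powRr1 (ltW y0)) -powRD; last by apply/implyP => _; rewrite gt_eqF.
  rewrite powRM ?powR_ge0//; last exact: le_trans ler01 K_ge1.
  rewrite -powRrM; congr (_ * _).
  rewrite -[X in _ = _ * X](powRr1 (ltW n0)) -powRD; last first.
    by apply/implyP => _; rewrite gt_eqF.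
  by congr (_ `^ _); move: beta_gt0; rewrite /p => ?; field; rewrite gt_eqF.
rewrite -mulr2n mulrnAr yE /c; move: (K `^ _) ((J * 3)%N%:R `^ _) => k z.
by rewrite natrM le_eqVlt; apply/orP; left; apply/eqP; ring.
Unshelve. all: by end_near. Qed.

End DigitProfile.

(** * Positions of the large digits and their effect on sums and products *)

Section ForcedDigits.
Variables (b : nat -> nat) (M : nat).
Implicit Types a : nat -> nat.

(* Each large digit is put between two unit digits, so that it enters exactly
   two of the products [a i * a i.+1], each time multiplied by 1. *)
Definition forced i : nat :=
  if (1 < b (i %/ 3))%N then (if i %% 3 == 1 then b (i %/ 3) else 1)%N else 0%N.

Lemma forced_block j r : (r < 3)%N -> forced (j * 3 + r) =
  if (1 < b j)%N then (if r == 1 then b j else 1)%N else 0%N.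
Proof. by move=> r3; rewrite /forced divnMDl// modnMDl modn_small// divn_small// addn0. Qed.

(** A large digit sits in the middle of its block, so its predecessor is the prescribed 1 of the
    same block and is not free. *)
Lemma forced_sep i : forced i = 0%N -> (forced i.+1 <= 1)%N.
Proof.
rewrite /forced; have [i1|] := eqVneq (i.+1 %% 3)%N 1%N; last by case: (1 < b (i.+1 %/ 3))%N.
have -> : (i.+1 %/ 3 = i %/ 3)%N by lia.
case: (ltnP 1 (b (i %/ 3))) => //= b1; case: (_ == _) => //= b0.
by rewrite b0 in b1.
Qed.

Hypothesis b_gt0 : forall j, (0 < b j)%N.
Hypothesis M_gt0 : (0 < M)%N.

Lemma admissible_block a j : admissible M forced a ->
  [/\ a (j * 3) = 1, a (j * 3).+1 = b j & a (j * 3).+2 = 1]%N \/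
  [/\ b j = 1, 0 < a (j * 3) <= M, 0 < a (j * 3).+1 <= M & 0 < a (j * 3).+2 <= M]%N.
Proof.
move=> aa; have := aa (j * 3 + 0)%N; have := aa (j * 3 + 1)%N; have := aa (j * 3 + 2)%N.
rewrite !forced_block// !addnS addn0 /=; case: (ltnP 1 (b j)) => bj; last first.
  by move=> h2 h1 h0; right; split=> //; apply/eqP; rewrite eqn_leq bj b_gt0.
rewrite (gtn_eqF (ltnW bj)).
by move=> /eqP h2 /eqP h1 /eqP h0; left.
Qed.

(** A prescribed block contributes 2 b plus one product at most M. In a free block b = 1, and the
    three products lie between 1 and M^2 each. *)
Lemma sum_products_bounds a J : admissible M forced a ->
  (2 * \sum_(j < J) b j <= \sum_(i < J * 3) a i * a i.+1 <=
   2 * \sum_(j < J) b j + M ^ 2 * (J * 3))%N.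
Proof.
move=> aa; elim: J => [|J /andP[l u]]; first by rewrite mul0n !big_ord0 !muln0.
rewrite -[J.+1]addn1 mulnDl mul1n addn1 !addnS addn0 !big_ord_recr/=.
set X := (\sum_(i < J * 3) _)%N in l u *; set Y := (\sum_(j < J) b j)%N in l u *.
(* The last product of a block involves the first digit of the next one, which is 1 or free, never
   large. *)
have a3 : (0 < a (J * 3).+3 <= M)%N.
  have := admissible_block J.+1 aa; rewrite mulSn !addSn add0n.
  by case=> [[-> _ _]|[_ ? _ _]].
move: a3 (admissible_block J aa) l u; move: (b_gt0 J) M_gt0.
move: {aa} (a (J * 3)%N) (a (J * 3).+1) (a (J * 3).+2) (a (J * 3).+3) (b J) X Y.
move: (J * 3)%N M => n m a0 a1 a2 a3 B X Y B0 m0 h3 [[-> -> ->]|[-> h0 h1 h2]] l u.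
  by apply/andP; split; nia.
have h x y : (0 < x <= m -> 0 < y <= m -> 0 < x * y <= m ^ 2)%N.
  move=> /andP[x0 xm] /andP[y0 ym]; rewrite muln_gt0 x0 y0/=.
  by rewrite expnS expn1 leq_mul.
have /andP[p0 q0] : (0 < a0 * a1 <= m ^ 2)%N := h _ _ h0 h1.
have /andP[p1 q1] : (0 < a1 * a2 <= m ^ 2)%N := h _ _ h1 h2.
have /andP[p2 q2] : (0 < a2 * a3 <= m ^ 2)%N := h _ _ h2 h3.
move: p0 q0 p1 q1 p2 q2 l u {h h0 h1 h2 h3}.
move: (a0 * a1)%N (a1 * a2)%N (a2 * a3)%N (m ^ 2)%N => x y z w p0 q0 p1 q1 p2 q2 l u.
by apply/andP; split; nia.
Qed.

End ForcedDigits.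

(** A prescribed block has factor (4 (b + 1))^2 <= b^8 for b >= 2, a free block factor 1. The
    product is therefore at most the exponential of 8 times the sum of the ln b, which is o(n). *)
Lemma prod_forced_subexp (R : realType) (b : nat -> nat) (theta : R) :
  (forall j, (0 < b j)%N) ->
  (\sum_(j < J) ln (b j)%:R) / J%:R @[J --> \oo] --> (0 : R) ->
  1 < theta ->
  exists C, forall n, \prod_(i < n) (forced b i).+1%:R ^+ 2 <= C * theta ^+ n.
Proof.
move=> b0 blim theta1.
have F1 i : 1 <= (forced b i).+1%:R ^+ 2 :> R by rewrite exprn_ege1// ler1n.
pose D J : R := \sum_(j < J) ln (b j)%:R.
have lnb0 j : 0 <= ln (b j)%:R :> R by rewrite ln_ge0// ler1n.
have block J : \prod_(i < J * 3) (forced b i).+1%:R ^+ 2 <= expR (8 * D J).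
  elim: J => [|J IH]; first by rewrite mul0n /D !big_ord0 mulr0 expR0.
  rewrite -[J.+1]addn1 mulnDl mul1n addn1 !addnS addn0 !big_ord_recr/=.
  rewrite /D big_ord_recr/= mulrDr expRD -!mulrA.
  have P0 : 0 <= \prod_(i < J * 3) (forced b i).+1%:R ^+ 2 :> R.
    by apply: prodr_ge0 => i _; rewrite exprn_ge0.
  apply: (ler_pM P0 _ IH); first by do !apply: mulr_ge0; rewrite ?exprn_ge0.
  rewrite -[(J * 3)%N]addn0 -!addnS !forced_block//=.
  have bJ := b0 J; have bR : 0 < (b J)%:R :> R by rewrite ltr0n.
  rewrite [8 * _]mulrC expRM_natr lnK ?posrE//.
  case: ltnP => bJ1; last first.
    by rewrite !expr1n !mulr1 exprn_ege1// ler1n.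
  have B2 : 2 <= (b J)%:R :> R by rewrite ler_nat.
  rewrite -[(b J).+1%:R]natr1; move: (b J)%:R B2 => B B2.
  rewrite [leLHS](_ : _ = (4 * (B + 1)) ^+ 2); last by ring.
  rewrite (exprM B 4 2); apply: lerXn2r; rewrite ?nnegrE; [lra|by rewrite exprn_ge0//; lra|].
  have : 4 <= B ^+ 2 by nra.
  have : B + 1 <= B ^+ 2 by nra.
  by rewrite (exprM B 2 2); move: (B ^+ 2) => B' ? ?; nra.
pose e := ln theta / 8; have e0 : 0 < e by rewrite divr_gt0// ln_gt0.
have [N _ NP] : \forall J \near \oo, D J / J%:R < e by exact: (cvgr_lt _ blim).
(* Beyond N the sum is below e n, and up to N it is at most D N by monotonicity. *)
exists (expR (8 * D N)) => n.
have Dmono i j : (i <= j)%N -> D i <= D j.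
  move=> ij; rewrite /D -!(big_mkord xpredT (fun k => ln (b k)%:R : R)).
  by rewrite (big_cat_nat (leq0n i) ij)//= lerDl sumr_ge0.
have Dn : D n <= D N + e * n%:R.
  have [nN|Nn] := leqP n N.
    by apply: le_trans (Dmono _ _ nN) _; rewrite lerDl mulr_ge0// ltW.
  have n0 : 0 < n%:R :> R by rewrite ltr0n (leq_ltn_trans _ Nn).
  have := NP n (ltnW Nn); rewrite /= ltr_pdivrMr// => /ltW/le_trans; apply.
  by rewrite lerDr /D sumr_ge0.
(* All factors are at least 1, so n positions may be enlarged to n whole blocks; D n is still
   o(n). *)
apply: (@le_trans _ _ (\prod_(i < n * 3) (forced b i).+1%:R ^+ 2)).
  have le3 : (n <= n * 3)%N by rewrite leq_pmulr.
  rewrite -!(big_mkord xpredT (fun i => (forced b i).+1%:R ^+ 2 : R)).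
  rewrite (big_cat_nat (leq0n n) le3)//=; apply: ler_peMr.
    by apply: prodr_ge0 => i _; rewrite exprn_ge0.
  by elim/big_rec : _ => // i x _ x1; rewrite mulr_ege1.
apply: (le_trans (block n)).
rewrite -[X in _ * X ^+ _](@lnK _ theta) ?posrE ?(lt_trans ltr01)//.
rewrite -expRM_natr -expRD ler_expR.
by have := Dn; rewrite /e; lra.
Qed.

(** * Asymptotics of the sums and the dimension of the level set *)

Lemma S_cfrac_value (R : realType) (a : nat -> nat) n : (forall i, (0 < a i)%N) ->
  S_ n (cfrac_value a : R) = (\sum_(i < n) a i * a i.+1)%N.
Proof.
move=> a0; rewrite /S_ big_add1/= big_mkord; apply: eq_bigr => i _.
by rewrite /partial_quotient/= cfrac_expansion_value.
Qed.

(** The sums increase with n, so they are squeezed between their values at the two ends of a block.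
    Across a block psi changes by a product of three ratios tending to 1, and the free products add
    only O(n) = o(psi). *)
Lemma sum_products_asymptotic (R : realType) (psi : nat -> R) (b a : nat -> nat) (M : nat) :
  (forall n, 0 < psi n) -> (forall m n, (m <= n)%N -> psi m <= psi n) ->
  n%:R / psi n @[n --> \oo] --> (0 : R) ->
  psi n.+1 / psi n @[n --> \oo] --> (1 : R) ->
  (forall j, (0 < b j)%N) -> (0 < M)%N ->
  (2 * \sum_(j < J) b j)%:R / psi (J * 3)%N @[J --> \oo] --> (1 : R) ->
  admissible M (forced b) a ->
  (\sum_(i < n.+1) a i * a i.+1)%:R / psi n @[n --> \oo] --> (1 : R).
Proof.
move=> psi0 psi_incr psi_lin psi_ratio b0 M0 blim aa.
pose ratio J := psi (J.+1 * 3)%N / psi (J * 3)%N.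
have mul3 : (J * 3)%N @[J --> \oo] --> \oo by exact: cvg_mulnr.
have psi_neq0 n : psi n != 0 by rewrite gt_eqF.
have ratio1 : ratio J @[J --> \oo] --> (1 : R).
  pose r n := psi n.+1 / psi n.
  have r3 : r n.+2 * (r n.+1 * r n) @[n --> \oo] --> (1 : R).
    have r1 : r n.+1 @[n --> \oo] --> (1 : R) by rewrite (cvg_shiftS r).
    have r2 : r n.+2 @[n --> \oo] --> (1 : R) by rewrite (cvg_shiftS (fun n => r n.+1)).
    have := cvgM r2 (cvgM r1 psi_ratio); rewrite !mulr1; exact.
  rewrite (_ : ratio = fun J => r (J * 3).+2 * (r (J * 3).+1 * r (J * 3)%N)).
    exact: (@cvg_comp _ _ _ (fun J => J * 3)%N
      (fun n => r n.+2 * (r n.+1 * r n)) _ \oo _ mul3 r3).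
  apply/funext => J; rewrite /ratio /r mulSn !addSn add0n.
  by field; rewrite !psi_neq0.
pose A J : R := (2 * \sum_(j < J) b j)%:R / psi (J * 3)%N.
pose N J : R := (J * 3)%N%:R / psi (J * 3)%N.
have N0 : N J @[J --> \oo] --> (0 : R).
  exact: (@cvg_comp _ _ _ (fun J => J * 3)%N (fun n => n%:R / psi n) _ \oo _ mul3 psi_lin).
have lower : A J * (ratio J)^-1 @[J --> \oo] --> (1 : R).
  have := cvgM blim (cvgV (oner_neq0 R) ratio1); rewrite invr1 mulr1; exact.
have upper : (A J.+1 + (M ^ 2)%N%:R * N J.+1) * ratio J @[J --> \oo] --> (1 : R).
  have AS : A J.+1 @[J --> \oo] --> (1 : R) by rewrite (cvg_shiftS A).
  have NS : N J.+1 @[J --> \oo] --> (0 : R) by rewrite (cvg_shiftS N).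
  have := cvgM (cvgD AS (cvgM (cvg_cst ((M ^ 2)%N%:R : R)) NS)) ratio1.
  rewrite mulr0 addr0 mulr1; exact.
have div3 : (n %/ 3)%N @[n --> \oo] --> \oo by exact: cvg_divnr.
apply: (squeeze_cvgr
  (f := fun n => A (n %/ 3)%N * (ratio (n %/ 3)%N)^-1)
  (h := fun n => (A (n %/ 3).+1 + (M ^ 2)%N%:R * N (n %/ 3).+1) * ratio (n %/ 3)%N)); last 2 first.
- exact: (@cvg_comp _ _ _ (fun n => n %/ 3)%N (fun J => A J * (ratio J)^-1) _ \oo _ div3 lower).
- exact: (@cvg_comp _ _ _ (fun n => n %/ 3)%N
    (fun J => (A J.+1 + (M ^ 2)%N%:R * N J.+1) * ratio J) _ \oo _ div3 upper).
near=> n; pose J := (n %/ 3)%N; rewrite -/J.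
have nJ : (J * 3 <= n)%N by exact: leq_trunc_div.
have nJ' : (n.+1 <= J.+1 * 3)%N by rewrite ltn_ceil.
have sum_le k l : (k <= l)%N ->
    (\sum_(i < k) a i * a i.+1 <= \sum_(i < l) a i * a i.+1)%N.
  move=> kl; rewrite -!(big_mkord xpredT (fun i => a i * a i.+1)%N).
  by rewrite [leqRHS](big_cat_nat (leq0n k) kl)//= leq_addr.
have /andP[l _] := sum_products_bounds b0 M0 J aa.
have /andP[_ u] := sum_products_bounds b0 M0 J.+1 aa.
apply/andP; split.
  rewrite (_ : A J * (ratio J)^-1 = (2 * \sum_(j < J) b j)%:R / psi (J.+1 * 3)%N); last first.
    by rewrite /A /ratio; field; rewrite !psi_neq0.
  apply: ler_pM => //; first by rewrite invr_ge0 ltW.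
    by rewrite ler_nat (leq_trans l)// sum_le// (leq_trans nJ).
  by rewrite lef_pV2 ?posrE// psi_incr// ltnW.
rewrite (_ : (A J.+1 + _ * N J.+1) * ratio J =
    (2 * \sum_(j < J.+1) b j + M ^ 2 * (J.+1 * 3))%:R / psi (J * 3)%N); last first.
  by rewrite natrD (natrM _ (M ^ 2)) /A /N /ratio; field; rewrite !psi_neq0.
apply: ler_pM => //; first by rewrite invr_ge0 ltW.
  by rewrite ler_nat (leq_trans _ u)// sum_le.
by rewrite lef_pV2 ?posrE// psi_incr.
Unshelve. all: by end_near. Qed.

Lemma ln_le_powR (R : realType) (phi : nat -> R) (c : R) : 0 < c ->
  (\forall n \near \oo, 1 < phi n) ->
  (limn_esup (fun n => (ln (ln (phi n)) / ln n%:R)%:E) < c%:E)%E ->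
  exists2 beta, 0 < beta < c & \forall n \near \oo, ln (phi n) <= n%:R `^ beta.
Proof.
move=> c0 phi1 /ereal_inf_lt[y [V VN <-] yc].
have [beta /andP[beta0 betac] betaP] : exists2 beta, 0 < beta < c &
    forall n, V n -> ln (ln (phi n)) / ln n%:R <= beta.
  have ub n : V n -> ((ln (ln (phi n)) / ln n%:R)%:E <= ereal_sup [set
      (ln (ln (phi n)) / ln n%:R)%:E | n in V])%E.
    by move=> Vn; apply: ereal_sup_ubound; exists n.
  case: (ereal_sup _) ub yc => [r| |] // ub; rewrite ?lte_fin => rc.
    (* The supremum r may be negative or zero; c / 2 keeps beta positive and below c. *)
    exists (Num.max r (c / 2)).
      by rewrite lt_max gt_max rc divr_gt0 ?orbT//=; lra.
    by move=> n /ub; rewrite lee_fin le_max => ->.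
  exists (c / 2); first by apply/andP; split; lra.
  by move=> n /ub.
exists beta; first by rewrite beta0.
near=> n.
have n1 : 1 < n%:R :> R by rewrite ltr1n; near: n; exact: nbhs_infty_gt.
have lnphi : 0 < ln (phi n) by rewrite ln_gt0//; near: n.
have := betaP n; rewrite ler_pdivrMr ?ln_gt0// => h.
rewrite -[leLHS]lnK ?posrE// /powR gt_eqF ?(lt_trans ltr01)// ler_expR.
by apply: h; near: n.
Unshelve. all: by end_near. Qed.

Theorem theorem1p6 (R : realType) (phi : nat -> R)
  (phi_gt0 : forall n, (0 < n)%N -> 0 < phi n)
  (phi_incr : forall m n, (0 < m)%N -> (m <= n)%N -> phi m <= phi n)
  (phi_superlinear : phi n / n%:R @[n --> \oo] --> +oo)
  (phi_ratio : phi n.+1 / phi n @[n --> \oo] --> (1 : R))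
  (phi_growth :
    (limn_esup (fun n => (ln (ln (phi n)) / ln n%:R)%:E) < (2^-1)%:E)%E) :
  hausdorff_dim (E_ phi) = 1%E.
Proof.
(* The shift makes positivity and monotonicity hold from index 0 on. *)
pose psi n := phi n.+1.
have psi_gt0 n : 0 < psi n by exact: phi_gt0.
have psi_incr m n : (m <= n)%N -> psi m <= psi n by move=> mn; exact: phi_incr.
have psi_ratio : psi n.+1 / psi n @[n --> \oo] --> (1 : R).
  by rewrite (cvg_shiftS (fun n => phi n.+1 / phi n)).
have psi_superlinear : n%:R / psi n @[n --> \oo] --> (0 : R).
  have V0 : (phi n.+1 / n.+1%:R)^-1 @[n --> \oo] --> (0 : R).
    apply/gtr0_cvgV0; first by near=> n; rewrite divr_gt0// phi_gt0.
    by rewrite (cvg_shiftS (fun n => phi n / n%:R)).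
  apply: (squeeze_cvgr (f := fun=> 0) _ (cvg_cst _) V0); near=> n.
  rewrite divr_ge0 ?(ltW (psi_gt0 n))//= invf_div ler_pM2r ?invr_gt0//.
  by rewrite ler_nat.
have psi_ge : \forall n \near \oo, n%:R < psi n.
  near=> n; rewrite -[ltRHS]mul1r -ltr_pdivrMr//.
  by near: n; exact: (cvgr_lt _ psi_superlinear).
have phi_gt1 : \forall n \near \oo, 1 < phi n.
  have : \forall n \near \oo, 1 < psi n.
    near=> n; have n1 : 1 <= n%:R :> R by rewrite ler1n; near: n; exact: nbhs_infty_gt.
    by apply: le_lt_trans n1 _; near: n.
  move=> [N _ NP]; exists N.+1 => // -[//|n] /= Nn; exact: NP.
have half0 : 0 < 2^-1 :> R by rewrite invr_gt0.
have [beta /andP[beta0 beta1] growth] := ln_le_powR half0 phi_gt1 phi_growth.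
(* The 3 comes from ln (1 + psi) <= ln 2 + ln psi <= 1 + (n + 1)^beta <= n^beta + 2 n^beta. *)
have psi_growth : \forall n \near \oo, ln (1 + psi n) <= 3 * n%:R `^ beta.
  have growthS : \forall n \near \oo, ln (psi n) <= n.+1%:R `^ beta.
    by case: growth => N _ NP; exists N => // n /= Nn; apply: NP; rewrite /= (leq_trans Nn).
  near=> n.
  have n1 : 1 <= n%:R :> R by rewrite ler1n; near: n; exact: nbhs_infty_gt.
  have psi1 : 1 < psi n by apply: le_lt_trans n1 _; near: n.
  have ln2 : ln 2 <= 1 :> R by apply: (@le_ln1Dx R 1); lra.
  apply: (@le_trans _ _ (ln (2 * psi n))); first by rewrite ler_ln ?posrE; lra.
  rewrite lnM ?posrE//.
  have lnpsi : ln (psi n) <= n.+1%:R `^ beta by near: n.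
  have nb : 1 <= n%:R `^ beta.
    by have := ler_powR n1 (ltW beta0); rewrite powRr0.
  have nS : n.+1%:R `^ beta <= 2 * n%:R `^ beta.
    apply: (@le_trans _ _ ((2 * n%:R) `^ beta)).
      apply: (ge0_ler_powR (ltW beta0)); rewrite ?nnegrE ?mulr_ge0//.
      by rewrite -natr1; lra.
    rewrite powRM// ler_pM2r; last by lra.
    have b1 : beta <= 1 by lra.
    by have := ler_powR (ler1n R 2) b1; rewrite powRr1.
  lra.
have K1 : 1 <= 3 :> R by rewrite ler1n.
pose b := big_digit psi beta.
have b_gt0 j : (0 < b j)%N by [].
have b_sum := cvg_sum_big_digit psi_gt0 psi_incr psi_superlinear beta0 beta1.
have b_ln := cvg_ln_big_digit psi_gt0 psi_incr beta0 beta1 K1 psi_growth.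
apply/eqP; rewrite eq_le; apply/andP; split.
  by apply: hausdorff_dim_le1 => x [_ /andP[x0 x1] _]; rewrite /= in_itv/= !ltW.
apply: le_ereal_inf_tmp => _ [s [s0 Es] <-]; rewrite lee_fin leNgt; apply/negP => s1.
have s01 : 0 <= s < 1 by rewrite s0.
(* If s < 1 gave measure 0, this would contradict the positive measure obtained once all values of
   admissible sequences are shown to lie in [E_ phi]. *)
have [M M0 /(_ (E_ phi))] := hausdorff_measure_cfrac (forced_sep (b := b))
  (fun theta => prod_forced_subexp (theta := theta) b_gt0 b_ln) s01.
rewrite Es eqxx => H; suff : false by []; apply: H => a aa.
have a_gt0 := admissible_gt0 aa.
split; [exact: cfrac_value_irrational|exact: cfrac_value01|].
rewrite -(cvg_shiftS (fun n => (S_ n (cfrac_value a))%:R / phi n)).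
rewrite [X in X n @[n --> _] --> _](_ : _ = fun n =>
    (\sum_(i < n.+1) a i * a i.+1)%N%:R / psi n); last first.
  by apply/funext => n; rewrite S_cfrac_value.
exact: (sum_products_asymptotic psi_gt0 psi_incr psi_superlinear psi_ratio
  b_gt0 M0 b_sum aa).
Unshelve. all: by end_near. Qed.
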